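(* Let $G=(G_N)$ be a uniform quizzy quantum group, with category of partitions $D$ and parameter $q=\pm1$, and let $L\leq M\leq N$ be integers. Consider the space $X=G_{MN}^L\subset U_{MN}^{L+}$ constructed by imposing to the standard coordinates of $U_{MN}^{L+}$ the relations $$\sum_{i_1\ldots i_s}\sum_{j_1\ldots j_s}\delta_\pi(i)\delta_\sigma(j)u_{i_1j_1}^{e_1}\cdots u_{i_sj_s}^{e_s}=L^{|\pi\vee\sigma|}$$ with $s=(e_1,\ldots,e_s)$ ranging over all colored integers and $\pi,\sigma$ over $D(0,s)$ (the partitions in $D$ having no upper legs). Then, with $a_{ij},b_{ij}$ denoting the standard coordinates of $G_M,G_N$, there are an action map $a:(G_M\times G_N)\times X\to X$ and a map $p:G_M\times G_N\to X$, given at the algebra level by $$\Phi(u_{ij})=\sum_{kl}a_{ik}\otimes b_{jl}^*\otimes u_{kl},\qquad\pi(u_{ij})=\sum_{l\leq L}a_{il}\otimes b_{jl}^*,$$ and these satisfy $a\circ(id\times p)=p\circ m$, where $m$ is the multiplication of $G_M\times G_N$, i.e. $(id\otimes\pi)\Phi=\Delta\pi$.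
   Context: A noncommutative compact space $X$ is the formal dual of a unital $C^*$-algebra $C(X)$; a map $X\to Y$ is a unital $*$-homomorphism $C(Y)\to C(X)$; $C(X\times Y)=C(X)\otimes C(Y)$ with the maximal tensor product. Compact quantum groups are compact matrix quantum groups in Woronowicz's sense with $S^2=id$: pairs $(C(G),u)$ with $u=(u_{ij})\in M_N(C(G))$ unitary with entries generating $C(G)$, with $\Delta(u_{ij})=\sum_ku_{ik}\otimes u_{kj}$, $\varepsilon(u_{ij})=\delta_{ij}$, $S(u_{ij})=u_{ji}^*$ (full versions of the algebras are used). The product quantum group has the comultiplication obtained from $\Delta\otimes\Delta$ by flipping the two middle tensor factors. An action $G\curvearrowright X$ is a unital $*$-homomorphism $\Phi:C(X)\to C(G)\otimes C(X)$ with $(\Delta\otimes id)\Phi=(id\otimes\Phi)\Phi$ and $(\varepsilon\otimes id)\Phi=id$. With $\bar u=(u_{ij}^* )$, $u^t=(u_{ji})$, $u^*=(u_{ji}^* )$: $C(U_N^+)=C^*((u_{ij})_{i,j\le N}\mid u,\bar u\text{ unitary})$, and $C(U_{MN}^{L+})$ is the universal $C^*$-algebra generated by $u_{ij}$, $i\le M$, $j\le N$, such that $uu^*,\bar uu^t$ are projections of trace $L$ (matrices $r=r^*=r^2$ with $\sum_ir_{ii}=L\cdot1$). Partitions: a colored integer is a word in $\circ,\bullet$ (a word $s=(e_1,\ldots,e_s)$ has length also denoted $s$); $u_{ij}^\circ=u_{ij}$, $u_{ij}^\bullet=u_{ij}^*$. $P(k,l)$ is the set of partitions of an upper row of points colored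 by $k$ and a lower row colored by $l$. A category of partitions is a collection $D=\bigcup_{kl}D(k,l)$, $D(k,l)\subset P(k,l)$, containing the identity (the string with upper point $\circ$ joined to lower point $\circ$), and stable under horizontal concatenation, vertical concatenation (when the middle colors match, deleting closed strings in the middle), and upside-down turning with reversing of the colors. $P_{even}$ is the category of partitions with all blocks of even size. $\mathcal{NC}_2$ is the category of noncrossing pairings which are matching: upper–upper and lower–lower strings connect $\circ-\bullet$, through strings connect equal colors. $\tau\leq\pi$ means that each block of $\pi$ is contained in a block of $\tau$. $\pi\vee\sigma$ is the finest partition coarser than both $\pi$ and $\sigma$ (merging intersecting blocks), $|\cdot|$ is the number of blocks. $\ker$ of a multi-index joins the positions with equal indices. For $\tau\in P_{even}$, $\varepsilon(\tau)=(-1)^c$, where $c$ is the number of switches between neighboring legs belonging to different blocks (legs being read around on one line) needed to make $\tau$ noncrossing (the parity is well defined). Kronecker symbols: at $q=1$, $\delta_\sigma(i)=1$ if $\ker i\leq\sigma$ and $0$ otherwise; at $q=-1$, $\delta_\sigma(i)=\varepsilon(\ker i)$ if $\ker i\leq\sigma$ and $0$ otherwise. For $\pi\in P_{even}(k,l)$, put $\dot T_\pi(e_{i_1}\otimes\cdots\otimes e_{i_k})=\sum_j\delta_\pi\binom ij e_{j_1}\otimes\cdots\otimes e_{j_l}$ with $\delta_\pi\binom ij=1$ (at $q=1$) or $\varepsilon(\ker\binom ij)$ (at $q=-1$) if $\ker\binom ij\leq\pi$, and $0$ otherwise. $G_N\subset U_N^+$ is quizzy, coming from $D\subset P_{even}$,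 when $Hom(u^{\otimes k},u^{\otimes l})=span(\dot T_\pi\mid\pi\in D(k,l))$ for all colored integers $k,l$, colored tensor powers being formed with $u^\circ=u$, $u^\bullet=\bar u$. A uniform quizzy quantum group is a family $G=(G_N)$ of such quantum groups, $H_N\subset G_N\subset U_N^+$ (with $H_N=\mathbb Z_2\wr S_N$), coming, for a fixed $q$, from a category of partitions $\mathcal{NC}_2\subset D\subset P_{even}$ that is stable by removing blocks. *)

(* Defs.v *)
From HB Require Import structures.
From mathcomp Require Import all_boot all_order all_fingroup all_algebra.
From mathcomp Require Import all_classical all_reals topology normedtype.
From mathcomp Require Import complex ring lra.
Set Implicit Arguments.
Unset Strict Implicit.
Unset Printing Implicit Defensive.
Import Order.TTheory GRing.Theory Num.Theory.
Import numFieldNormedType.Exports.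
Local Notation Re := complex.Re.
Local Notation Im := complex.Im.
Local Open Scope ring_scope.
Local Open Scope complex_scope.

(* MathComp has no join of the ring and the normed module hierarchies, so the
   real-valued norm and its sequential completeness are part of the mixin.
   As always with algType, 1 != 0. *)
HB.mixin Record isCStarAlgebra (R : realType) A of GRing.Algebra R[i] A := {
  star : A -> A;
  starK : involutive star;
  starD : {morph star : x y / x + y};
  starZ : forall (c : R[i]) (x : A), star (c *: x) = c^* *: star x;
  starM : forall x y : A, star (x * y) = star y * star x;
  cnorm : A -> R;
  cnorm_eq0 : forall x : A, cnorm x = 0 -> x = 0;
  cnormD : forall x y : A, cnorm (x + y) <= cnorm x + cnorm y;
  cnormZ : forall (c : R[i]) (x : A), cnorm (c *: x) = Re `|c| * cnorm x;
  cnormM : forall x y : A, cnorm (x * y) <= cnorm x * cnorm y;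
  cnorm_star : forall x : A, cnorm (star x * x) = cnorm x ^+ 2;
  cnorm_complete : forall s : nat -> A,
    (forall e : R, 0 < e -> exists n0, forall m n, (n0 <= m)%N -> (n0 <= n)%N ->
      cnorm (s m - s n) < e) ->
    exists l, forall e : R, 0 < e -> exists n0, forall n, (n0 <= n)%N ->
      cnorm (s n - l) < e }.

#[short(type="cstarType")]
HB.structure Definition CStarAlgebra (R : realType) :=
  {A of GRing.Algebra R[i] A & isCStarAlgebra R A}.

Record starHom (R : realType) (A B : cstarType R) := StarHom {
  starHom_map :> {lrmorphism A -> B};
  starHom_star : forall x, starHom_map (star x) = star (starHom_map x) }.

Section StarHomTheory.
Variable R : realType.
Implicit Types A B C : cstarType R.

Section MkStarHom.
Variables (A B : cstarType R) (f : A -> B).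
Hypothesis f_lin : linear f.
Hypothesis f_mul : monoid_morphism f.
Hypothesis f_star : forall x, f (star x) = star (f x).

Definition mk_map of linear f & monoid_morphism f := f.
HB.instance Definition _ :=
  GRing.isLinear.Build R[i] A B *:%R (mk_map f_lin f_mul) f_lin.
HB.instance Definition _ :=
  GRing.isMonoidMorphism.Build A B (mk_map f_lin f_mul) f_mul.
Definition mk_starHom : starHom A B :=
  @StarHom R A B (mk_map f_lin f_mul : {lrmorphism A -> B}) f_star.
End MkStarHom.

Lemma idH_star A (x : A) : (idfun : {lrmorphism A -> A}) (star x) = star x.
Proof. by []. Qed.
Definition idH A : starHom A A :=
  @StarHom R A A (idfun : {lrmorphism A -> A}) (@idH_star A).

Lemma compH_star A B C (g : starHom B C) (f : starHom A B) (x : A) :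
  (g \o f : {lrmorphism A -> C}) (star x) =
  star ((g \o f : {lrmorphism A -> C}) x).
Proof. by rewrite /= !starHom_star. Qed.
Definition compH A B C (g : starHom B C) (f : starHom A B) : starHom A C :=
  @StarHom R A C (g \o f : {lrmorphism A -> C}) (compH_star g f).

End StarHomTheory.

Definition scalars (R : realType) : Type := R[i].

Section Scalars.
Variable R : realType.
Local Open Scope classical_set_scope.

HB.instance Definition _ := GRing.ComAlgebra.copy (scalars R) (R[i]^o).

Lemma seq_complete (s : nat -> R) :
  (forall e : R, 0 < e -> exists n0, forall m n, (n0 <= m)%N -> (n0 <= n)%N ->
      `|s m - s n| < e) ->
  exists l, forall e : R, 0 < e -> exists n0, forall n, (n0 <= n)%N ->
      `|s n - l| < e.
Proof.
move=> cs.
have : cvg (s @ \oo).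
  apply: cauchy_cvg; apply: cauchy_exP => e e0.
  have [n0 h] := cs _ e0; exists (s n0); exists n0 => // n /= hn.
  by rewrite -ball_normE /ball_ /=; exact: h.
move=> /cvgrPdist_lt sl; exists (lim (s @ \oo)) => e e0.
have [n0 _ h] := sl _ e0; exists n0 => n hn.
by rewrite distrC; exact: h.
Qed.

Lemma normcE (x : R[i]) : Re `|x| = Normc.normc x. Proof. by []. Qed.

Lemma normcRI (x : R[i]) : Re `|x| <= `|Re x| + `|Im x|.
Proof.
case: x => a b /=; rewrite -(@ler_pXn2r _ 2) ?nnegrE ?sqrtr_ge0 ?addr_ge0 //.
rewrite sqr_sqrtr ?addr_ge0 ?sqr_ge0 // sqrrD !real_normK ?num_real //.
by rewrite addrAC lerDl mulrn_wge0 // mulr_ge0.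
Qed.

Lemma normc_Re (x : R[i]) : `|Re x| <= Re `|x|.
Proof.
case: x => a b /=; rewrite -sqrtr_sqr ler_wsqrtr // lerDl sqr_ge0 //.
Qed.

Lemma normc_Im (x : R[i]) : `|Im x| <= Re `|x|.
Proof.
case: x => a b /=; rewrite -sqrtr_sqr ler_wsqrtr // lerDr sqr_ge0 //.
Qed.

Let N (x : scalars R) : R := Re `|(x : R[i])|.

Lemma scalars_norm_eq0 (x : scalars R) : N x = 0 -> x = 0.
Proof. exact: Normc.eq0_normc. Qed.

Lemma scalars_normD (x y : scalars R) : N (x + y) <= N x + N y.
Proof.
have := ler_normD (x : R[i]) y.
by rewrite lecE => /andP[_]; rewrite raddfD.
Qed.

Lemma scalars_normM (x y : scalars R) : N (x * y) = N x * N y.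
Proof. exact: Normc.normcM. Qed.

Lemma scalars_normJ (x : scalars R) : N ((x : R[i])^*) = N x.
Proof. by case: x => a b; rewrite /N /= sqrrN. Qed.

Lemma scalars_norm_submul (x y : scalars R) : N (x * y) <= N x * N y.
Proof. by rewrite scalars_normM. Qed.

Lemma scalars_norm_star (x : scalars R) : N ((x : R[i])^* * x) = N x ^+ 2.
Proof. by rewrite scalars_normM scalars_normJ. Qed.

Lemma scalars_complete (s : nat -> scalars R) :
  (forall e : R, 0 < e -> exists n0, forall m n, (n0 <= m)%N -> (n0 <= n)%N ->
      N (s m - s n) < e) ->
  exists l, forall e : R, 0 < e -> exists n0, forall n, (n0 <= n)%N ->
      N (s n - l) < e.
Proof.
move=> cs.
have [a ha] : exists l, forall e : R, 0 < e -> exists n0, forall n, (n0 <= n)%N ->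
      `|Re (s n : R[i]) - l| < e.
  apply: seq_complete => e /cs[n0 h]; exists n0 => m n hm hn.
  apply: le_lt_trans (h _ _ hm hn).
  by rewrite -(raddfB (@Re R)); exact: normc_Re.
have [b hb] : exists l, forall e : R, 0 < e -> exists n0, forall n, (n0 <= n)%N ->
      `|Im (s n : R[i]) - l| < e.
  apply: seq_complete => e /cs[n0 h]; exists n0 => m n hm hn.
  apply: le_lt_trans (h _ _ hm hn).
  by rewrite -(raddfB (@Im R)); exact: normc_Im.
exists (a +i* b) => e e0.
have e2 : 0 < e / 2%:R by rewrite divr_gt0.
have [n1 h1] := ha _ e2; have [n2 h2] := hb _ e2.
exists (maxn n1 n2) => n; rewrite geq_max => /andP[hn1 hn2].
apply: le_lt_trans (normcRI _) _.
rewrite [e]splitr; apply: ltrD.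
  by move: (h1 _ hn1); case: (s n).
by move: (h2 _ hn2); case: (s n).
Qed.

HB.instance Definition _ := @isCStarAlgebra.Build R (scalars R)
  (fun x : R[i] => x^*) (@conjcK R) (rmorphD _)
  (fun c x => rmorphM (@conjc R) c x)
  (fun x y => etrans (rmorphM (@conjc R) x y) (mulrC _ _))
  N scalars_norm_eq0 scalars_normD (fun c x => scalars_normM c x)
  scalars_norm_submul scalars_norm_star scalars_complete.

End Scalars.

(* The maximal tensor product is determined, up to a unique isomorphism, by
   universality for pairs of commuting unital *-homomorphisms. *)
Record max_tensor (R : realType) (A B : cstarType R) := MaxTensor {
  tens_alg :> cstarType R;
  tinl : starHom A tens_alg;
  tinr : starHom B tens_alg;
  tens_comm : forall a b, GRing.comm (tinl a) (tinr b);
  tlift : forall (C : cstarType R) (f : starHom A C) (g : starHom B C),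
    (forall a b, GRing.comm (f a) (g b)) -> starHom tens_alg C;
  tlift_inl : forall (C : cstarType R) (f : starHom A C) (g : starHom B C)
      (fg : forall a b, GRing.comm (f a) (g b)) a,
    @tlift C f g fg (tinl a) = f a;
  tlift_inr : forall (C : cstarType R) (f : starHom A C) (g : starHom B C)
      (fg : forall a b, GRing.comm (f a) (g b)) b,
    @tlift C f g fg (tinr b) = g b;
  tens_ext : forall (C : cstarType R) (h h' : starHom tens_alg C),
    (forall a, h (tinl a) = h' (tinl a)) ->
    (forall b, h (tinr b) = h' (tinr b)) -> forall x, h x = h' x }.

Arguments tinl {R A B} m.
Arguments tinr {R A B} m.
Arguments tens_ext {R A B m C}.

Section NormTheory.
Variables (R : realType) (A : cstarType R).
Implicit Types x y : A.

Lemma cnorm0 : cnorm (0 : A) = 0.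
Proof. by rewrite -(scale0r (0 : A)) cnormZ normr0 mul0r. Qed.

Lemma cnormN x : cnorm (- x) = cnorm x.
Proof. by rewrite -scaleN1r cnormZ normrN1 mul1r. Qed.

Lemma cnorm_ge0 x : 0 <= cnorm x.
Proof.
have := cnormD x (- x); rewrite subrr cnorm0 cnormN -mulr2n.
by rewrite pmulrn_lge0.
Qed.

Lemma cnorm_le_eq0 x : (forall e : R, 0 < e -> cnorm x <= e) -> x = 0.
Proof.
move=> h; apply: cnorm_eq0; apply/eqP; rewrite eq_le cnorm_ge0 andbT.
by apply/ler_addgt0Pl => e e0; rewrite addr0; exact: h.
Qed.

Lemma half_exp_small (e : R) : 0 < e ->
  exists n0, forall n, (n0 <= n)%N -> (2^-1) ^+ n < e.
Proof.
move=> e0; exists (Num.bound e^-1) => n hn.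
rewrite exprVn -[e]invrK ltf_pV2 ?posrE ?invr_gt0 ?exprn_gt0 //.
apply: lt_le_trans (archi_boundP _) _; first by rewrite invr_ge0 ltW.
by rewrite -natrX ler_nat (leq_trans hn) // ltnW // ltn_expl.
Qed.

Lemma neumann y : cnorm y <= 2^-1 ->
  exists w, (1 - y) * w = 1 /\ w * (1 - y) = 1.
Proof.
move=> hy; pose K := cnorm (1 : A); have K0 : 0 <= K by exact: cnorm_ge0.
pose s n := \sum_(k < n) y ^+ k.
have hX k : cnorm (y ^+ k) <= K * 2^-1 ^+ k.
  elim: k => [|k IH]; first by rewrite !expr0 mulr1.
  rewrite !exprS (le_trans (cnormM _ _)) // mulrCA.
  by rewrite ler_pM // cnorm_ge0.
have hs n p : cnorm (s (n + p)%N - s n) <= K * (2 * 2^-1 ^+ n - 2 * 2^-1 ^+ (n + p)).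
  elim: p => [|p IH]; first by rewrite addn0 !subrr mulr0 cnorm0.
  rewrite addnS /s big_ord_recr /= addrAC (le_trans (cnormD _ _)) //.
  apply: le_trans (lerD IH (hX _)) _.
  rewrite -mulrDr ler_wpM2l // [_ ^+ (n + p).+1]exprS mulrA divff ?pnatr_eq0 // mul1r.
  by set t := _ ^+ (n + p); set r := _ ^+ n; lra.
have hs' a b : (a <= b)%N -> cnorm (s b - s a) <= K * 2 * 2^-1 ^+ a.
  move=> /subnKC <-; apply: le_trans (hs a _) _.
  by rewrite -mulrA ler_wpM2l // lerBlDr lerDl mulr_ge0 ?exprn_ge0 ?invr_ge0 ?ler0n.
have K2 : 0 < K * 2 + 1 by rewrite ltr_wpDl // mulr_ge0.
have [e e0|w hw] := cnorm_complete s.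
  have [n0 h0] := half_exp_small (divr_gt0 (divr_gt0 e0 K2) (ltr0n R 2)).
  have h1 n : (n0 <= n)%N -> cnorm (s n - s n0) < e / 2.
    move=> hn; apply: le_lt_trans (hs' _ _ hn) _.
    apply: (@le_lt_trans _ _ ((K * 2 + 1) * 2^-1 ^+ n0)).
      by rewrite ler_wpM2r ?exprn_ge0 ?invr_ge0 ?ler0n // lerDl.
    by have := h0 n0 (leqnn _); rewrite mulrAC ltr_pdivlMr // mulrC.
  exists n0 => m n hm hn.
  have -> : s m - s n = (s m - s n0) + - (s n - s n0) by rewrite opprB addrA subrK.
  rewrite [e]splitr; apply: le_lt_trans (cnormD _ _) _.
  by rewrite cnormN ltrD // h1.
have hl n : (1 - y) * s n = 1 - y ^+ n by rewrite -opprB mulNr -subrX1 opprB.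
have hr n : s n * (1 - y) = 1 - y ^+ n.
  rewrite -hl; apply/commr_sym/commr_sum => k _.
  by apply: commrX; apply: commr_sym; apply: commrB; [exact: commr1|].
pose C := cnorm (1 - y) + K + 1.
have C0 : 0 < C by rewrite ltr_wpDl // addr_ge0 // cnorm_ge0.
have key (e : R) : 0 < e -> exists n, cnorm (w - s n) < e / C /\ 2^-1 ^+ n < e / C.
  move=> e0; have eC : 0 < e / C by rewrite divr_gt0.
  have [n1 h1] := hw _ eC; have [n2 h2] := half_exp_small eC.
  exists (maxn n1 n2); rewrite h2 ?leq_maxr // -opprB cnormN.
  by rewrite h1 ?leq_maxl.
have fin (e : R) n : 0 < e -> cnorm (w - s n) < e / C -> 2^-1 ^+ n < e / C ->
    cnorm (1 - y) * cnorm (w - s n) + K * 2^-1 ^+ n <= e.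
  move=> e0 /ltW a1 /ltW a2.
  apply: (@le_trans _ _ (cnorm (1 - y) * (e / C) + K * (e / C))).
    by rewrite lerD // ler_wpM2l // cnorm_ge0.
  by rewrite -mulrDl mulrA ler_pdivrMr // mulrC ler_pM2l // /C lerDl.
exists w; split; apply/eqP; rewrite -subr_eq0; apply/eqP;
  apply: cnorm_le_eq0 => e e0; have [n [a1 a2]] := key _ e0.
  have -> : (1 - y) * w - 1 = (1 - y) * (w - s n) - y ^+ n.
    by rewrite mulrBr hl opprB addrA addrAC addrK.
  apply: le_trans (fin _ _ e0 a1 a2); apply: le_trans (cnormD _ _) _.
  by rewrite cnormN lerD // cnormM.
have -> : w * (1 - y) - 1 = (w - s n) * (1 - y) - y ^+ n.
  by rewrite mulrBl hr opprB addrA addrAC addrK.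
apply: le_trans (fin _ _ e0 a1 a2); apply: le_trans (cnormD _ _) _.
by rewrite cnormN lerD // mulrC cnormM.
Qed.
End NormTheory.

Lemma comm_inv (A : nzRingType) (z u w : A) :
  u * w = 1 -> w * u = 1 -> GRing.comm z u -> GRing.comm z w.
Proof.
move=> uw wu zu; rewrite /GRing.comm -[LHS]mul1r -wu -!mulrA (mulrA u) -zu.
by rewrite -(mulrA z) uw mulr1.
Qed.

Section HomComm.
Variables (R : realType) (A B C : cstarType R) (T : max_tensor A B).
Variable h : starHom T C.

Lemma star1 (D : cstarType R) : star (1 : D) = 1.
Proof. by rewrite -[LHS]mulr1 -[X in _ * X]starK -starM mulr1 starK. Qed.

Lemma starN (D : cstarType R) (x : D) : star (- x) = - star x.
Proof. by rewrite -scaleN1r starZ rmorphN rmorph1 scaleN1r. Qed.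

Section Conj.
Variable v : C.
Hypotheses (v1 : v * star v = 1) (v2 : star v * v = 1).
Let f x := v * h x * star v.

Let f_lin : linear f.
Proof. by move=> k x y; rewrite /f linearP mulrDr mulrDl -scalerAr -scalerAl. Qed.
Let f_mul : monoid_morphism f.
Proof.
split=> [|x y]; first by rewrite /f rmorph1 mulr1.
by rewrite /f rmorphM !mulrA -(mulrA (v * h x)) v2 mulr1.
Qed.
Let f_star x : f (star x) = star (f x).
Proof. by rewrite /f starHom_star !starM starK mulrA. Qed.
Definition conj_hom : starHom T C := mk_starHom f_lin f_mul f_star.

Lemma hom_comm_unitary :
  (forall a, GRing.comm (h (tinl T a)) v) ->
  (forall b, GRing.comm (h (tinr T b)) v) -> forall x, GRing.comm (h x) v.
Proof.
move=> ca cb x.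
have E y : GRing.comm (h y) v -> conj_hom y = h y.
  by move=> yv; rewrite /= /mk_map /f -yv -mulrA v1 mulr1.
have := tens_ext conj_hom h (fun a => E _ (ca a)) (fun b => E _ (cb b)) x.
rewrite /= /mk_map /f => Ex.
by rewrite /GRing.comm -[in LHS]Ex -!mulrA v2 mulr1.
Qed.
End Conj.

Lemma hom_comm_small (c : C) : star c = c -> cnorm c <= 2^-1 ->
  (forall a, GRing.comm (h (tinl T a)) c) ->
  (forall b, GRing.comm (h (tinr T b)) c) -> forall x, GRing.comm (h x) c.
Proof.
move=> cs cn ca cb x.
have iu : ('i : R[i]) * - 'i = 1 by rewrite mulrN -expr2 sqr_i opprK.
pose y := ('i : R[i]) *: c.
have ys : star y = - y.
  by rewrite /y starZ cs -scaleNr; congr (_ *: _); apply/eqP; rewrite eq_complex /= oppr0 !eqxx.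
have yn : cnorm y <= 2^-1.
  by rewrite /y cnormZ /= expr0n expr1n add0r sqrtr1 mul1r.
have yc z : GRing.comm z c <-> GRing.comm z y.
  rewrite /GRing.comm /y -scalerAr -scalerAl; split=> [->//|E].
  have := congr1 (fun t => (- 'i : R[i]) *: t) E.
  by rewrite !scalerA mulrC iu !scale1r.
have [w [yw wy]] := neumann yn.
have yw' : star w * (1 + y) = 1.
  by have := congr1 (@star _ _) yw; rewrite starM star1 starD starN ys opprK star1.
have wy' : (1 + y) * star w = 1.
  by have := congr1 (@star _ _) wy; rewrite starM star1 starD starN ys opprK star1.
pose v := (1 + y) * w.
have yw1 : y * w = w - 1 by rewrite -yw mulrBl mul1r opprB addrCA subrr addr0.
have vE : v = w + (w - 1) by rewrite /v mulrDl mul1r yw1.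
have vs : star v = star w * (1 - y) by rewrite /v starM starD star1 ys.
have yy : (1 - y) * (1 + y) = (1 + y) * (1 - y).
  by rewrite mulrBl mulrBr !mulrDl !mulrDr !mul1r !mulr1.
have v2 : star v * v = 1.
  by rewrite vs /v mulrA -(mulrA _ (1 - y)) yy mulrA yw' mul1r yw.
have v1 : v * star v = 1.
  have v3 : v * ((1 - y) * star w) = 1.
    by rewrite /v mulrA -(mulrA (1 + y)) wy mulr1 wy'.
  suff -> : star v = (1 - y) * star w by [].
  transitivity (star v * (v * ((1 - y) * star w))); first by rewrite v3 mulr1.
  by rewrite mulrA v2 mul1r.
have cv z : GRing.comm z c -> GRing.comm z v.
  move=> /yc zy; apply: commrM; first by apply: commrD => //; exact: commr1.
  by apply: (comm_inv yw wy); apply: commrB => //; exact: commr1.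
have := hom_comm_unitary v1 v2 (fun a => cv _ (ca a)) (fun b => cv _ (cb b)) x.
rewrite vE => hv; apply/yc.
have hw : GRing.comm (h x) w.
  have w2 : 2^-1 *: (w + (w - 1) + 1) = w.
    rewrite addrA subrK -mulr2n -[w *+ 2]scaler_nat scalerA mulVf ?scale1r //.
    by rewrite pnatr_eq0.
  rewrite -w2 /GRing.comm -scalerAr -scalerAl; congr (_ *: _).
  by apply: commrD => //; exact: commr1.
have := comm_inv wy yw hw => h1y.
have -> : y = 1 - (1 - y) by rewrite opprB addrCA subrr addr0.
by apply: commrB => //; exact: commr1.
Qed.

Lemma hom_comm_self (c : C) : star c = c ->
  (forall a, GRing.comm (h (tinl T a)) c) ->
  (forall b, GRing.comm (h (tinr T b)) c) -> forall x, GRing.comm (h x) c.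
Proof.
move=> cs ca cb x.
pose t : R := (2 * (cnorm c + 1))^-1.
have c1 : 0 < cnorm c + 1 by rewrite ltr_wpDl ?cnorm_ge0.
have t0 : 0 < t by rewrite invr_gt0 mulr_gt0.
have tC : t%:C != 0 by rewrite eq_complex /= eqxx andbT gt_eqF.
have tc z : GRing.comm z c <-> GRing.comm z (t%:C *: c).
  rewrite /GRing.comm -scalerAr -scalerAl; split=> [->//|E].
  have := congr1 (fun u => (t%:C)^-1 *: u) E.
  by rewrite !scalerA mulVf // !scale1r.
apply/tc; apply: hom_comm_small => [||a|b]; [| |exact/tc|exact/tc].
  by rewrite starZ cs; congr (_ *: _); exact: conjc_real.
rewrite cnormZ /= expr0n addr0 sqrtr_sqr ger0_norm ?(ltW t0) //.
rewrite /t invfM -mulrA mulrC ler_pdivrMr ?mulr_gt0 //. 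
by rewrite mulVf ?pnatr_eq0 // mulrC ler_pdivrMr // mul1r lerDl.
Qed.

Lemma hom_comm (c : C) :
  (forall a, GRing.comm (h (tinl T a)) c) ->
  (forall b, GRing.comm (h (tinr T b)) c) -> forall x, GRing.comm (h x) c.
Proof.
move=> ca cb x.
have cs (D : cstarType R) (k : starHom D T) : (forall d, GRing.comm (h (k d)) c) ->
    forall d, GRing.comm (h (k d)) (star c).
  move=> kc d; have := kc (star d); rewrite !starHom_star => E.
  have := congr1 (@star _ _) E; rewrite !starM starK => E'.
  by rewrite /GRing.comm E'.
have ca' := cs _ _ ca; have cb' := cs _ _ cb.
pose p := c + star c; pose q := ('i : R[i]) *: (star c - c).
have ii : ('i : R[i])^* = - 'i by apply/eqP; rewrite eq_complex /= oppr0 !eqxx.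
have ps : star p = p by rewrite /p starD starK addrC.
have qs : star q = q.
  transitivity (- 'i *: (c - star c) : C).
    by rewrite starZ starD starN starK; congr (_ *: _); exact: ii.
  by rewrite scaleNr -scalerN opprB.
have cZ z d (k : R[i]) : GRing.comm z d -> GRing.comm z (k *: d : C).
  by move=> zd; rewrite /GRing.comm -scalerAr -scalerAl zd.
have hp : GRing.comm (h x) p by apply: hom_comm_self => // a; exact: commrD.
have hq : GRing.comm (h x) q.
  by apply: hom_comm_self => // a; apply: cZ; apply: commrB.
have -> : c = 2^-1 *: (p + 'i *: q).
  rewrite /q scalerA -expr2 sqr_i scaleN1r opprB /p addrACA subrr addr0.
  rewrite -mulr2n -[c *+ 2]scaler_nat scalerA mulVf ?scale1r //.
  by rewrite pnatr_eq0.
by apply: (cZ); apply: commrD => //; exact: cZ.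
Qed.

End HomComm.

Lemma tlift_commr (R : realType) (A B C : cstarType R) (T : max_tensor A B)
    (f : starHom A C) (g : starHom B C)
    (fg : forall a b, GRing.comm (f a) (g b)) (c : C) :
  (forall a, GRing.comm (f a) c) -> (forall b, GRing.comm (g b) c) ->
  forall x, GRing.comm (tlift T fg x) c.
Proof.
move=> fc gc; apply: hom_comm => ?; first by rewrite tlift_inl.
by rewrite tlift_inr.
Qed.

Section TensorMaps.
Variable R : realType.
Implicit Types A B C : cstarType R.

Definition tpure A B (T : max_tensor A B) (a : A) (b : B) : T :=
  tinl T a * tinr T b.

Section TensMap.
Variables (A B A' B' : cstarType R).
Variables (T : max_tensor A B) (T' : max_tensor A' B').
Variables (f : starHom A A') (g : starHom B B').

Lemma tmap_comm a b :
  GRing.comm (compH (tinl T') f a) (compH (tinr T') g b).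
Proof. exact: tens_comm. Qed.

Definition tmap : starHom T T' := tlift T tmap_comm.

Lemma tmap_pure a b : tmap (tpure T a b) = tpure T' (f a) (g b).
Proof. by rewrite rmorphM /= /tmap tlift_inl tlift_inr. Qed.
End TensMap.

Section Flip.
Variables (A A' B B' : cstarType R).
Variables (TA : max_tensor A A') (TB : max_tensor B B').
Variables (T : max_tensor A B) (T' : max_tensor A' B').
Variables (U : max_tensor TA TB) (V : max_tensor T T').

Lemma flip_comm (x : TA) (y : TB) :
  GRing.comm (tmap TA V (tinl T) (tinl T') x) (tmap TB V (tinr T) (tinr T') y).
Proof.
apply: tlift_commr => [a|a']; apply: commr_sym; apply: tlift_commr => [b|b'] /=.
- by rewrite /GRing.comm -!rmorphM tens_comm.
- exact/commr_sym/tens_comm.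
- exact: tens_comm.
- by rewrite /GRing.comm -!rmorphM tens_comm.
Qed.

Definition flip_mid : starHom U V := tlift U flip_comm.

Lemma flip_mid_pure a a' b b' :
  flip_mid (tpure U (tpure TA a a') (tpure TB b b')) =
  tpure V (tpure T a b) (tpure T' a' b').
Proof.
rewrite /flip_mid rmorphM /= tlift_inl tlift_inr !tmap_pure /tpure !rmorphM /=.
by rewrite !mulrA; congr (_ * _); rewrite -!mulrA; congr (_ * _); exact/esym/tens_comm.
Qed.
End Flip.

Section Assoc.
Variables (A B C : cstarType R).
Variables (AB : max_tensor A B) (BC : max_tensor B C).
Variables (U : max_tensor AB C) (V : max_tensor A BC).

Lemma assoc_comm1 a b : GRing.comm (tinl V a) (compH (tinr V) (tinl BC) b).
Proof. exact: tens_comm. Qed.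

Lemma assoc_comm2 (x : AB) (c : C) :
  GRing.comm (tlift AB assoc_comm1 x) (compH (tinr V) (tinr BC) c).
Proof.
apply: tlift_commr => [a|b]; first exact: tens_comm.
by rewrite /GRing.comm /= -!rmorphM tens_comm.
Qed.

Definition tassoc : starHom U V := tlift U assoc_comm2.

Lemma tassoc_pure a b c :
  tassoc (tpure U (tpure AB a b) c) = tpure V a (tpure BC b c).
Proof.
rewrite /tassoc /tpure rmorphM /= tlift_inl tlift_inr rmorphM /= tlift_inl.
by rewrite tlift_inr /= rmorphM mulrA.
Qed.
End Assoc.

Section Unit.
Variable A : cstarType R.

Let f (c : scalars R) : A := (c : R[i])%:A.
Let f_lin : linear f.
Proof. by move=> k x y; rewrite /f scalerDl -scalerA. Qed.
Let f_mul : monoid_morphism f.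
Proof.
split=> [|x y]; first exact: scale1r.
by rewrite /f -scalerAl mul1r scalerA.
Qed.
Let f_star x : f (star x) = star (f x).
Proof. by rewrite /f starZ star1. Qed.
Definition scal_hom : starHom (scalars R) A := mk_starHom f_lin f_mul f_star.

Lemma scal_homE (c : scalars R) : scal_hom c = (c : R[i])%:A.
Proof. by []. Qed.

Lemma scal_hom_comm (c : scalars R) (x : A) : GRing.comm (scal_hom c) x.
Proof. by rewrite scal_homE /GRing.comm -scalerAl -scalerAr mul1r mulr1. Qed.
End Unit.

(* e (x) id : P (x) A -> C (x) A = A for a character e of P *)
Section Slice.
Variables (P A : cstarType R) (T : max_tensor P A) (e : starHom P (scalars R)).

Lemma slice_comm p a : GRing.comm (compH (scal_hom A) e p) (idH A a).
Proof. exact: scal_hom_comm. Qed.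

Definition slice : starHom T A := tlift T slice_comm.

Lemma slice_pure p a : slice (tpure T p a) = (e p : R[i]) *: a.
Proof.
by rewrite /slice rmorphM /= tlift_inl tlift_inr /= -scalerAl mul1r.
Qed.
End Slice.

End TensorMaps.

Section Cstar.
Variable R : realType.
Local Open Scope classical_set_scope.

Definition star_subalg (A : cstarType R) (S : set A) : Prop :=
  [/\ S 1,
      forall (c : R[i]) x y, S x -> S y -> S (c *: x + y),
      forall x y, S x -> S y -> S (x * y) &
      forall x, S x -> S (star x)].

Definition star_gen (A : cstarType R) m n (u : 'M[A]_(m, n)) : set A :=
  smallest (@star_subalg A) [set u i j | i in setT & j in setT].

Definition cdense (A : cstarType R) (S : set A) : Prop :=
  forall (x : A) (e : R), 0 < e -> exists2 y, S y & cnorm (x - y) < e.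

Definition star_hom_on (A B : cstarType R) (S : set A) (f : A -> B) : Prop :=
  [/\ f 1 = 1,
      forall (c : R[i]) x y, S x -> S y -> f (c *: x + y) = c *: f x + f y,
      forall x y, S x -> S y -> f (x * y) = f x * f y &
      forall x, S x -> f (star x) = star (f x)].

Definition conj_mx (A : cstarType R) m n (u : 'M[A]_(m, n)) : 'M[A]_(m, n) :=
  map_mx (@star R A) u.
Definition adj_mx (A : cstarType R) m n (u : 'M[A]_(m, n)) : 'M[A]_(n, m) :=
  (conj_mx u)^T.
Definition unitary_mx (A : cstarType R) n (u : 'M[A]_n) : Prop :=
  u *m adj_mx u = 1%:M /\ adj_mx u *m u = 1%:M.

(* (A, u) is the universal C*-algebra generated by the entries of an m x n
   matrix subject to the relations P *)
Definition universal_cstar m n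
    (P : forall B : cstarType R, 'M[B]_(m, n) -> Prop)
    (A : cstarType R) (u : 'M[A]_(m, n)) : Prop :=
  [/\ P A u,
      forall (B : cstarType R) (v : 'M[B]_(m, n)), P B v ->
        exists f : starHom A B, forall i j, f (u i j) = v i j &
      forall (B : cstarType R) (f g : starHom A B),
        (forall i j, f (u i j) = g (u i j)) -> forall x, f x = g x].

Variable tens : forall A B : cstarType R, max_tensor A B.

Record cmqg (n : nat) := Cmqg {
  qg_alg : cstarType R;
  qg_u : 'M[qg_alg]_n;
  qg_unitary : unitary_mx qg_u;
  qg_dense : cdense (star_gen qg_u);
  (* C(G) is the full version: the enveloping C*-algebra of the dense
     *-algebra generated by the entries of u *)
  qg_full : forall (B : cstarType R) (f : qg_alg -> B),
    star_hom_on (star_gen qg_u) f ->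
    exists F : starHom qg_alg B, forall x, star_gen qg_u x -> F x = f x;
  qg_comul : starHom qg_alg (tens qg_alg qg_alg);
  qg_comulE : forall i j,
    qg_comul (qg_u i j) = \sum_k tpure (tens _ _) (qg_u i k) (qg_u k j);
  qg_counit : starHom qg_alg (scalars R);
  qg_counitE : forall i j, qg_counit (qg_u i j) = (i == j)%:R;
  qg_antipode : {linear qg_alg -> qg_alg};
  qg_antipode1 : qg_antipode 1 = 1;
  qg_antipodeM : forall x y,
    qg_antipode (x * y) = qg_antipode y * qg_antipode x;
  qg_antipode_star : forall x, qg_antipode (star x) = star (qg_antipode x);
  qg_antipodeE : forall i j, qg_antipode (qg_u i j) = star (qg_u j i) }.

Definition prod_alg m n (G : cmqg m) (H : cmqg n) :
    max_tensor (qg_alg G) (qg_alg H) := tens (qg_alg G) (qg_alg H).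

(* (id (x) flip (x) id) (Delta_G (x) Delta_H) *)
Definition prod_comul m n (G : cmqg m) (H : cmqg n) :
    starHom (prod_alg G H) (tens (prod_alg G H) (prod_alg G H)) :=
  let DG := tens (qg_alg G) (qg_alg G) in
  let DH := tens (qg_alg H) (qg_alg H) in
  let GH := prod_alg G H in
  compH (flip_mid (tens DG DH) (tens GH GH))
        (tmap GH (tens DG DH) (qg_comul G) (qg_comul H)).

Lemma prod_counit_comm m n (G : cmqg m) (H : cmqg n) x y :
  GRing.comm (qg_counit G x) (qg_counit H y).
Proof. exact: mulrC. Qed.

Definition prod_counit m n (G : cmqg m) (H : cmqg n) :
    starHom (prod_alg G H) (scalars R) :=
  tlift (prod_alg G H) (@prod_counit_comm m n G H).

(* (Delta (x) id) Phi = (id (x) Phi) Phi, with (A (x) A) (x) B identified with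
   A (x) (A (x) B), and (eps (x) id) Phi = id *)
Definition is_qaction (A B : cstarType R) (Delta : starHom A (tens A A))
    (eps : starHom A (scalars R)) (Phi : starHom B (tens A B)) : Prop :=
  (forall x,
     tassoc (tens (tens A A) B) (tens A (tens A B))
       (tmap (tens A B) (tens (tens A A) B) Delta (idH B) (Phi x)) =
     tmap (tens A B) (tens A (tens A B)) (idH A) Phi (Phi x)) /\
  (forall x, slice (tens A B) eps (Phi x) = x).

End Cstar.

(* Colored integers are words in white = true and black = false. The points
   of P(k, l) are inl r (upper row) and inr r (lower row). *)
Definition white : bool := true.
Definition black : bool := false.
Definition color (k : seq bool) (r : 'I_(size k)) : bool := tnth (in_tuple k) r.
Definition pt (k l : seq bool) : finType := ('I_(size k) + 'I_(size l))%type.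
Definition ptset (k l : seq bool) := {set {set pt k l}}.
Definition part_family := forall k l : seq bool, {set ptset k l}.

(* The legs read around the diagram on one line: the upper row from left to
   right, then the lower row from right to left *)
Definition legs (k l : seq bool) : seq (pt k l) :=
  [seq inl r | r <- enum 'I_(size k)] ++ rev [seq inr r | r <- enum 'I_(size l)].
Definition word k l (tau : ptset k l) : seq {set pt k l} :=
  [seq finset.pblock tau x | x <- legs k l].

Definition noncrossing_word (T : eqType) (w : seq T) : Prop :=
  forall x y, subseq [:: x; y; x; y] w -> x = y.

(* w' is obtained from w by c switches of distinct neighbors *)
Inductive switches (T : eqType) : nat -> seq T -> seq T -> Prop :=
| Switch0 w : switches 0 w w
| SwitchS c s t x y w : x != y ->
    switches c (s ++ y :: x :: t) w -> switches c.+1 (s ++ x :: y :: t) w.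

(* On P_even the parity of c does not depend on the choice made by xget. *)
Definition signature k l (tau : ptset k l) : int :=
  (-1) ^+ xget 0%N [set c : nat | exists2 w, switches c (word tau) w &
                                       noncrossing_word w]%classic.

Definition even_partition k l (pi : ptset k l) : bool :=
  finset.partition pi [set: pt k l] && [forall B in pi, ~~ odd #|B|].

Definition nc_matching_pairing k l (pi : ptset k l) : Prop :=
  [/\ finset.partition pi [set: pt k l],
      forall B, B \in pi -> #|B| = 2%N,
      noncrossing_word (word pi) &
      forall B x y, B \in pi -> x \in B -> y \in B -> x != y ->
        match x, y with
        | inl r, inl s => color r != color s
        | inr r, inr s => color r != color s
        | inl r, inr s => color r == color s
        | inr r, inl s => color r == color s
        end].

(* coarser tau pi is tau <= pi, in the convention where the coarser partition
   is the smaller one. *)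
Definition coarser k l (tau pi : ptset k l) : bool :=
  [forall B in pi, exists C in tau, (B : {set pt k l}) \subset C].

Definition same_block (T : finType) (P : {set {set T}}) : rel T :=
  fun x y => [exists B in P, (x \in B) && (y \in B)].

Definition pjoin k l (pi sigma : ptset k l) : ptset k l :=
  finset.equivalence_partition (connect (same_block (pi :|: sigma))) [set: pt k l].

Definition hcat_l k l k' l' (x : pt k l) : pt (k ++ k') (l ++ l') :=
  match x with
  | inl r => inl (cast_ord (esym (size_cat k k')) (lshift _ r))
  | inr r => inr (cast_ord (esym (size_cat l l')) (lshift _ r))
  end.
Definition hcat_r k l k' l' (x : pt k' l') : pt (k ++ k') (l ++ l') :=
  match x with
  | inl r => inl (cast_ord (esym (size_cat k k')) (rshift _ r))
  | inr r => inr (cast_ord (esym (size_cat l l')) (rshift _ r))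
  end.
Definition hcat k l k' l' (pi : ptset k l) (sigma : ptset k' l') :
    ptset (k ++ k') (l ++ l') :=
  [set @hcat_l k l k' l' @: B | B : {set pt k l} in pi] :|:
  [set @hcat_r k l k' l' @: B | B : {set pt k' l'} in sigma].

(* Vertical concatenation with pi above sigma: two outer points are joined when
   they are connected through the three rows k, l, m, so that closed strings in
   the middle row disappear. *)
Definition row3 (k l m : seq bool) : finType :=
  ('I_(size k) + ('I_(size l) + 'I_(size m)))%type.
Definition row12 k l m (x : pt k l) : row3 k l m :=
  match x with inl r => inl r | inr r => inr (inl r) end.
Definition row23 k l m (x : pt l m) : row3 k l m := inr x.
Definition row13 k l m (x : pt k m) : row3 k l m :=
  match x with inl r => inl r | inr r => inr (inr r) end.
Definition vcat k l m (pi : ptset k l) (sigma : ptset l m) : ptset k m :=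
  let glued : {set {set row3 k l m}} :=
    [set @row12 k l m @: B | B : {set pt k l} in pi] :|:
    [set @row23 k l m @: B | B : {set pt l m} in sigma] in
  finset.equivalence_partition
    (fun x y => connect (same_block glued) (row13 l x) (row13 l y))
    [set: pt k m].

Definition flip_pt k l (x : pt k l) : pt (map negb l) (map negb k) :=
  match x with
  | inl r => inr (cast_ord (esym (size_map negb k)) r)
  | inr r => inl (cast_ord (esym (size_map negb l)) r)
  end.
Definition upside_down k l (pi : ptset k l) : ptset (map negb l) (map negb k) :=
  [set @flip_pt k l @: B | B : {set pt k l} in pi].

Definition kept_up k l (B : {set pt k l}) : seq 'I_(size k) :=
  [seq r <- enum 'I_(size k) | inl r \notin B].
Definition kept_lo k l (B : {set pt k l}) : seq 'I_(size l) :=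
  [seq r <- enum 'I_(size l) | inr r \notin B].
Definition kept_pt k l (B : {set pt k l})
    (x : pt (map (@color k) (kept_up B)) (map (@color l) (kept_lo B))) : pt k l :=
  match x with
  | inl r => inl (tnth (in_tuple (kept_up B))
                       (cast_ord (size_map (@color k) (kept_up B)) r))
  | inr r => inr (tnth (in_tuple (kept_lo B))
                       (cast_ord (size_map (@color l) (kept_lo B)) r))
  end.
Definition remove_block k l (pi : ptset k l) (B : {set pt k l}) :
    ptset (map (@color k) (kept_up B)) (map (@color l) (kept_lo B)) :=
  [set @kept_pt k l B @^-1: C | C : {set pt k l} in pi :\ B].

Record category_of_partitions (D : part_family) : Prop := {
  cat_partition : forall k l pi, pi \in D k l ->
    finset.partition pi [set: pt k l];
  cat_id : [set [set: pt [:: white] [:: white]]] \in D [:: white] [:: white];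
  cat_hcat : forall k l k' l' pi sigma, pi \in D k l -> sigma \in D k' l' ->
    hcat pi sigma \in D (k ++ k') (l ++ l');
  cat_vcat : forall k l m pi sigma, pi \in D k l -> sigma \in D l m ->
    vcat pi sigma \in D k m;
  cat_upside_down : forall k l pi, pi \in D k l ->
    upside_down pi \in D (map negb l) (map negb k) }.

Definition multi (k : seq bool) (n : nat) := {ffun 'I_(size k) -> 'I_n}.

Definition glue_multi k l n (i : multi k n) (j : multi l n) (x : pt k l) : 'I_n :=
  match x with inl r => i r | inr r => j r end.

Definition ker k l n (i : multi k n) (j : multi l n) : ptset k l :=
  finset.preim_partition (glue_multi i j) [set: pt k l].

Definition kron (q : int) k l n (pi : ptset k l) (i : multi k n) (j : multi l n) :
    int :=
  if coarser (ker i j) pi then (if q == 1 then 1 else signature (ker i j)) else 0.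

Definition no_index n : multi [::] n := ffun0 (card_ord 0).

Section Quizzy.
Variable R : realType.

Definition colored (A : cstarType R) (e : bool) (x : A) : A :=
  if e then x else star x.

(* The product u_{i_1 j_1}^{e_1} ... u_{i_s j_s}^{e_s}, which for a square
   matrix u is the (i, j) entry of the colored tensor power of u *)
Definition tpow (A : cstarType R) m n (u : 'M[A]_(m, n)) (s : seq bool)
    (i : multi s m) (j : multi s n) : A :=
  \prod_(r < size s) colored (color r) (u (i r) (j r)).

(* Hom(u^k, u^l): linear maps T with matrix entries T j i, i an input and
   j an output multi-index *)
Definition intertwiner (A : cstarType R) n (u : 'M[A]_n) (k l : seq bool)
    (T : multi l n -> multi k n -> R[i]) : Prop :=
  forall j i, \sum_(i' : multi k n) T j i' *: tpow u i' i =
              \sum_(j' : multi l n) T j' i *: tpow u j j'.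

Variable tens : forall A B : cstarType R, max_tensor A B.

Definition quizzy (q : int) (D : part_family) n (G : cmqg tens n) : Prop :=
  forall k l (T : multi l n -> multi k n -> R[i]),
    intertwiner (qg_u G) T <->
    exists c : ptset k l -> R[i], forall j i,
      T j i = \sum_(pi in D k l) c pi * (kron q pi i j)%:~R.

(* H_n = Z_2 wr S_n consists of the signed permutation matrices. *)
Definition signed_perm_mx n (h : 'S_n * {ffun 'I_n -> bool}) : 'M[R[i]]_n :=
  \matrix_(i, j) ((-1) ^+ h.2 i * (h.1 i == j)%:R).

(* A unital *-homomorphism C(G) -> C(H_n) is a family of characters of C(G)
   indexed by the points of the finite group H_n. *)
Definition contains_hyperoctahedral n (G : cmqg tens n) : Prop :=
  exists F : 'S_n * {ffun 'I_n -> bool} -> starHom (qg_alg G) (scalars R),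
    forall h i j, F h (qg_u G i j) = signed_perm_mx h i j.

(* A unital *-homomorphism C(U_n^+) -> C(G) mapping coordinates to
   coordinates exists iff u and its conjugate satisfy the relations defining
   C(U_n^+). *)
Definition in_free_unitary n (G : cmqg tens n) : Prop :=
  unitary_mx (qg_u G) /\ unitary_mx (conj_mx (qg_u G)).

Record uniform_quizzy (q : int) (D : part_family) (G : forall n, cmqg tens n) :
    Prop := {
  uq_q : q = 1 \/ q = -1;
  uq_category : category_of_partitions D;
  uq_nc2 : forall k l (pi : ptset k l), nc_matching_pairing pi -> pi \in D k l;
  uq_even : forall k l pi, pi \in D k l -> even_partition pi;
  uq_remove : forall k l pi (B : {set pt k l}), pi \in D k l -> B \in pi ->
    remove_block pi B \in D _ _;
  uq_hyperoctahedral : forall n, (0 < n)%N -> contains_hyperoctahedral (G n);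
  uq_free_unitary : forall n, (0 < n)%N -> in_free_unitary (G n);
  uq_quizzy : forall n, (0 < n)%N -> quizzy q D (G n) }.

Definition projection_of_trace (A : cstarType R) m (L : nat) (r : 'M[A]_m) : Prop :=
  [/\ adj_mx r = r, r *m r = r & \tr r = L%:R].

(* The defining relations of C(U_{MN}^{L+}) *)
Definition partial_isometry_rel (L M N : nat) (A : cstarType R)
    (u : 'M[A]_(M, N)) : Prop :=
  projection_of_trace L (u *m adj_mx u) /\
  projection_of_trace L (conj_mx u *m u^T).

Definition GMNL_rel (q : int) (D : part_family) (L M N : nat) (A : cstarType R)
    (u : 'M[A]_(M, N)) : Prop :=
  partial_isometry_rel L u /\
  forall (s : seq bool) (pi sigma : ptset [::] s),
    pi \in D [::] s -> sigma \in D [::] s ->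
    \sum_(i : multi s M) \sum_(j : multi s N)
      tpow u i j *~ (kron q pi (no_index M) i * kron q sigma (no_index N) j) =
    ((L ^ #|pjoin pi sigma|)%N)%:R.

End Quizzy.

(* Main.v *)
From HB Require Import structures.
Require Import Defs.
From mathcomp Require Import all_boot all_order all_fingroup all_algebra.
From mathcomp Require Import all_classical all_reals.
From mathcomp Require Import complex.

Set Implicit Arguments.
Unset Strict Implicit.
Unset Printing Implicit Defensive.

Import Order.TTheory GRing.Theory Num.Theory.
Local Open Scope ring_scope.
Local Notation partition := finset.partition.
Local Notation pblock := finset.pblock.
Local Notation ker := Defs.ker.

(** The coordinates of G_M x G_N transform a solution v of the relations of X
    into the translate x v y^*, where x and y are the fundamental matrices of
    G_M and G_N, placed in a common algebra so that the entries of x, y and v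
    commute with one another.  Everything follows from two facts.

    A translate of a solution is a solution (GMNL_rel_translate).  The
    conditions on v v^* and its conjugate survive because x, y and their
    conjugates are unitary; the trace of x P x^* is that of P because the
    entries of x commute with those of P and the transpose of x is unitary as
    well.  For the remaining relations, the commutation splits the monomials of
    the translate (tpow_translate), and one needs that the Kronecker symbols of
    D are fixed by the tensor powers of x acting on row indices, and by those
    of the conjugate of y.  The intertwiners between 1 and u^s that come from
    D(0, s) give the invariance with respect to column indices, and the
    antipode exchanges rows and columns (fixes_kron_coordinates).  For the
    conjugate matrix the colors are reversed; turning the partition upside down
    reverses them back and places the legs in the upper row, where row indices
    are the ones summed over (fixes_kron_conj_coordinates).  This operation
    reads the legs in the opposite order, which does not affect the number of
    switches needed to uncross a partition, hence preserves the Kronecker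
    symbols at q = -1 too (kron_upside_down).

    The scalar matrix J with L ones on the diagonal is a solution
    (GMNL_rel_pid_mx): only equal row and column indices below L contribute,
    the two signs are equal and cancel, and what remains is the number of
    multi-indices that are constant on the blocks of both partitions, that is,
    of the colorings of the blocks of the join by L colors
    (card_invariant_ffun).

    Translating the universal solution gives Phi, and translating J gives p.
    The action axioms and the equivariance are identities between morphisms out
    of C(X), hence need only be compared on the coordinates, where they reduce
    to the comultiplication of the products of a coordinate of G_M and an
    adjoint coordinate of G_N (prod_comul_coef). *)

(** * Functions constant on the classes of a relation *)

(** Such a function is a free choice of a value on each connected component,
    so composing with the class map is a bijection from the functions on the
    set of components. *)
Lemma card_invariant_ffun (T X : finType) (e : rel T) : symmetric e ->
  #|[set f : {ffun T -> X} | [forall x, forall y, e x y ==> (f x == f y)]]| =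
  (#|X| ^ #|equivalence_partition (connect e) [set: T]|)%N.
Proof.
move=> e_sym; pose P := equivalence_partition (connect e) [set: T].
have cls_subproof x : [set y in [set: T] | connect e x y] \in P by exact: imset_f.
pose cls x : {B | B \in P} := exist (fun B => B \in P) _ (cls_subproof x).
have clsP x y : cls x = cls y -> connect e x y.
  by move/(congr1 val)/setP/(_ y); rewrite !inE connect0.
have cls_connect x y : connect e x y -> cls x = cls y.
  move=> xy; apply: val_inj; apply/setP=> z; rewrite !inE /=.
  exact: (same_connect (sym_connect_sym e_sym) xy).
have cls_surj (B : {B | B \in P}) : {x | cls x = B}.
  apply: cid; case: B => B BP; have /imsetP[x _ Bx] := BP; exists x.
  by apply: val_inj; rewrite /= Bx.
pose h (d : {ffun {B | B \in P} -> X}) := [ffun x => d (cls x)].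
have h_inj : injective h.
  move=> d d' /ffunP E; apply/ffunP=> B; have [x <-] := cls_surj B.
  by have := E x; rewrite !ffunE.
rewrite -(card_sig (mem P)) -card_ffun -cardsT -(card_imset _ h_inj).
apply: eq_card => f; rewrite inE; apply/idP/imsetP => [/forallP fe|[d _ ->]].
  have f_connect x y : connect e x y -> f x = f y.
    case/connectP=> p; elim: p x => [|z p IH] x /= => [_ -> //|/andP[xz zp] yE].
    by rewrite -(IH _ zp yE); apply/eqP; move/forallP: (fe x) => /(_ z)/implyP; apply.
  exists [ffun B => f (sval (cls_surj B))] => //; apply/ffunP=> x; rewrite !ffunE.
  by apply: f_connect; apply: clsP; case: (cls_surj (cls x)).
apply/forallP=> x; apply/forallP=> y; apply/implyP=> xy; rewrite !ffunE.
by rewrite (cls_connect _ _ (connect1 xy)).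
Qed.

(** * Kronecker symbols and kernels of multi-indices *)

Lemma mem_ker k l n (i : multi k n) (j : multi l n) x :
  [set y | glue_multi i j x == glue_multi i j y] \in ker i j.
Proof. by apply/imsetP; exists x => //; apply/setP=> y; rewrite !inE. Qed.

Lemma ker_blockP k l n (i : multi k n) (j : multi l n) B : B \in ker i j ->
  exists x, B = [set y | glue_multi i j x == glue_multi i j y].
Proof.
by case/imsetP=> x _ ->; exists x; apply/setP=> y; rewrite !inE.
Qed.

(** Kernels only see coincidences of indices, not the range of the indices:
    this allows comparing multi-indices with values in 'I_L, 'I_M and 'I_N. *)
Lemma eq_ker k l m n (i : multi k m) (j : multi l m) (i' : multi k n)
    (j' : multi l n) :
  (forall x y, (glue_multi i j x == glue_multi i j y) =
               (glue_multi i' j' x == glue_multi i' j' y)) ->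
  ker i j = ker i' j'.
Proof.
by move=> E; apply: eq_imset => x; apply/setP=> y; rewrite !inE /= E.
Qed.

Lemma coarser_kerP k l n (pi : ptset k l) (i : multi k n) (j : multi l n) :
  partition pi [set: pt k l] ->
  reflect (forall x y, same_block pi x y -> glue_multi i j x = glue_multi i j y)
          (coarser (ker i j) pi).
Proof.
case/and3P=> _ _ pi0; apply: (iffP forallP) => [co x y|co B].
  case/existsP=> B /andP[Bpi /andP[xB yB]].
  have /existsP[C /andP[/ker_blockP[z ->] BC]] := implyP (co B) Bpi.
  have := fintype.subsetP BC _ xB; have := fintype.subsetP BC _ yB; rewrite !inE.
  by move=> /eqP <- /eqP <-.
apply/implyP=> Bpi; case: (finset.set_0Vmem B) => [B0|[x xB]].
  by rewrite -B0 Bpi in pi0.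
apply/existsP; exists [set y | glue_multi i j x == glue_multi i j y].
rewrite mem_ker /=; apply/fintype.subsetP=> y yB; rewrite inE; apply/eqP/co.
by apply/existsP; exists B; rewrite Bpi xB.
Qed.

(** The value of the Kronecker symbol on multi-indices with kernel tau, when it
    does not vanish. *)
Definition block_sign (q : int) k l (tau : ptset k l) : int :=
  if q == 1 then 1 else signature tau.

Lemma kronE q k l n (pi : ptset k l) (i : multi k n) (j : multi l n) :
  kron q pi i j = (coarser (ker i j) pi)%:R * block_sign q (ker i j).
Proof. by rewrite /kron; case: coarser; rewrite ?mul1r ?mul0r. Qed.

Lemma block_sign_sqr q k l (tau : ptset k l) : block_sign q tau ^+ 2 = 1.
Proof. by rewrite /block_sign; case: eqP; rewrite ?expr1n // sqrr_sign. Qed.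

(** A multi-index contributes to both Kronecker symbols when it is constant on
    the blocks of pi and on those of sigma, hence along chains of such blocks. *)
Lemma card_constant_on_join s L (pi sigma : ptset [::] s) :
  partition pi [set: pt [::] s] -> partition sigma [set: pt [::] s] ->
  #|[set c : multi s L | coarser (ker (no_index L) c) pi &&
                         coarser (ker (no_index L) c) sigma]| =
  (L ^ #|pjoin pi sigma|)%N.
Proof.
move=> pip sip; rewrite -[L in RHS]card_ord /pjoin -card_invariant_ffun; last first.
  by move=> x y; apply: eq_existsb => B; rewrite [(x \in B) && _]andbC.
pose h (c : multi s L) : {ffun pt [::] s -> 'I_L} := finfun (glue_multi (no_index L) c).
have h_inj : injective h.
  by move=> c d /ffunP E; apply/ffunP=> r; have := E (inr r); rewrite !ffunE.
rewrite -(card_imset _ h_inj); apply: eq_card => f.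
have same_blockU x y : same_block (pi :|: sigma) x y =
    same_block pi x y || same_block sigma x y.
  apply/existsP/orP => [[B /andP[]]|].
    rewrite inE => /orP[] Bp xy; [left|right]; apply/existsP; exists B; exact/andP.
  by case=> /existsP[B /andP[Bp xy]]; exists B; rewrite inE Bp ?orbT.
rewrite [RHS]inE; apply/imsetP/idP => [[c]|/forallP fe].
  rewrite inE => /andP[/(coarser_kerP _ _ pip) c1 /(coarser_kerP _ _ sip) c2] ->.
  apply/forallP=> x; apply/forallP=> y; apply/implyP; rewrite same_blockU !ffunE.
  by case/orP=> [/c1|/c2] ->.
have fE x : glue_multi (no_index L) [ffun r => f (inr r)] x = f x.
  by case: x => [[]//|r] /=; rewrite ffunE.
exists [ffun r => f (inr r)]; last by apply/ffunP=> x; rewrite ffunE fE.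
have fxy x y : same_block (pi :|: sigma) x y -> f x = f y.
  by move=> xy; apply/eqP; move/forallP: (fe x) => /(_ y)/implyP; apply.
rewrite inE; apply/andP; split; apply/coarser_kerP => // x y xy; rewrite !fE.
  by apply: fxy; rewrite same_blockU xy.
by apply: fxy; rewrite same_blockU xy orbT.
Qed.

(** * Turning partitions upside down *)

Lemma switches_rev (T : eqType) c (w w' : seq T) :
  switches c w w' -> switches c (rev w) (rev w').
Proof.
elim=> [v|{}c s t x y v xy _ IH]; first exact: Switch0.
rewrite rev_cat !rev_cons -!cats1 -!catA /=; apply: SwitchS; first by rewrite eq_sym.
by move: IH; rewrite rev_cat !rev_cons -!cats1 -!catA.
Qed.

Lemma noncrossing_rev (T : eqType) (w : seq T) :
  noncrossing_word w -> noncrossing_word (rev w).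
Proof.
by move=> nc x y; rewrite -subseq_rev revK => /nc.
Qed.

Lemma switches_map (T U : eqType) (f : T -> U) c (w w' : seq T) : injective f ->
  switches c w w' -> switches c (map f w) (map f w').
Proof.
move=> f_inj; elim=> [v|{}c s t x y v xy _ IH]; first exact: Switch0.
rewrite map_cat /=; apply: SwitchS; first by rewrite (inj_eq f_inj).
by move: IH; rewrite map_cat.
Qed.

Lemma noncrossing_map (T U : eqType) (f : T -> U) (g : U -> T) (w : seq T) :
  cancel f g -> cancel g f -> noncrossing_word w -> noncrossing_word (map f w).
Proof.
move=> fK gK nc x y /(map_subseq g); rewrite (mapK fK) => /nc.
exact: (can_inj gK).
Qed.

(** The numbers of switches among which signature picks one; signature depends
    on the word of the partition through this set only, hence is unchanged by
    any transformation of words that preserves it. *)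
Definition uncrossed_by (T : eqType) (w : seq T) : set nat :=
  [set c : nat | exists2 w', switches c w w' & noncrossing_word w']%classic.

(** Reading a sequence of switches from right to left switches the reversed
    words, and the pattern x y x y is a pattern y x y x from the right. *)
Lemma uncrossed_by_rev (T : eqType) (w : seq T) :
  uncrossed_by (rev w) = uncrossed_by w.
Proof.
have sub (v : seq T) c : uncrossed_by v c -> uncrossed_by (rev v) c.
  by case=> w' vw nc; exists (rev w'); [exact: switches_rev|exact: noncrossing_rev].
by apply/seteqP; split=> c /sub //; rewrite revK.
Qed.

Lemma uncrossed_by_map (T U : eqType) (f : T -> U) (g : U -> T) (w : seq T) :
  cancel f g -> cancel g f -> uncrossed_by (map f w) = uncrossed_by w.
Proof.
have sub (V W : eqType) (h : V -> W) (h' : W -> V) v c : cancel h h' -> cancel h' h ->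
    uncrossed_by v c -> uncrossed_by (map h v) c.
  move=> hK h'K [w' vw nc]; exists (map h w'); last exact: noncrossing_map nc.
  exact: switches_map (can_inj hK) vw.
move=> fK gK; apply/seteqP; split=> c; last exact: sub.
by move/(sub _ _ g f) => /(_ gK fK); rewrite (mapK fK).
Qed.

Definition unflip_pt k l (x : pt (map negb l) (map negb k)) : pt k l :=
  match x with
  | inl r => inr (cast_ord (size_map negb l) r)
  | inr r => inl (cast_ord (size_map negb k) r)
  end.

Lemma flip_ptK k l : cancel (@flip_pt k l) (@unflip_pt k l).
Proof. by case=> r /=; rewrite cast_ordKV. Qed.

Lemma unflip_ptK k l : cancel (@unflip_pt k l) (@flip_pt k l).
Proof. by case=> r /=; rewrite cast_ordK. Qed.

Section UpsideDown.
Variables k l : seq bool.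

Let flip := @flip_pt k l.
Let flip_inj : injective flip := can_inj (@flip_ptK k l).

Let flipsK : cancel (fun B : {set pt k l} => flip @: B)
                    (fun C : {set pt _ _} => flip @^-1: C).
Proof. by move=> B; apply/setP=> x; rewrite !inE mem_imset. Qed.

Let unflipsK : cancel (fun C : {set pt _ _} => flip @^-1: C)
                      (fun B : {set pt k l} => flip @: B).
Proof. by move=> C; apply/setP=> x; rewrite -[x]unflip_ptK mem_imset // inE. Qed.

Lemma map_cast_enum m n (e : m = n) :
  map (cast_ord e) (enum 'I_m) = enum 'I_n.
Proof.
by case: n / e; rewrite -[RHS]map_id; apply: eq_map => r; exact: cast_ord_id.
Qed.

Lemma legs_upside_down :
  legs (map negb l) (map negb k) = rev (map flip (legs k l)).
Proof.
rewrite /legs map_cat map_rev rev_cat revK; congr (_ ++ rev _).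
  by rewrite -(map_cast_enum (esym (size_map negb l))) -!map_comp.
by rewrite -(map_cast_enum (esym (size_map negb k))) -!map_comp.
Qed.

Lemma pblock_upside_down (tau : ptset k l) x : partition tau [set: pt k l] ->
  pblock (upside_down tau) (flip x) = flip @: pblock tau x.
Proof.
case/and3P=> /eqP cov tri _; apply: def_pblock.
- apply/finset.trivIsetP=> B C /imsetP[B' B't ->] /imsetP[C' C't ->] BC.
  have BC' : B' != C' by apply: contraNneq BC => ->.
  rewrite -setI_eq0 -imsetI; last by move=> y z _ _; exact: flip_inj.
  have := finset.trivIsetP tri _ _ B't C't BC'; rewrite -setI_eq0 => /eqP ->.
  by rewrite imset0.
- by apply: imset_f; apply: finset.pblock_mem; rewrite cov inE.
- by apply: imset_f; rewrite finset.mem_pblock cov inE.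
Qed.

(** Going around the diagram from its upper left corner before the turning
    amounts to going around it in the opposite direction afterwards. *)
Lemma signature_upside_down (tau : ptset k l) : partition tau [set: pt k l] ->
  signature (upside_down tau) = signature tau.
Proof.
move=> taup.
have wordE : word (upside_down tau) =
    rev (map (fun B : {set pt k l} => flip @: B) (word tau)).
  rewrite /word legs_upside_down map_rev -!map_comp; congr rev.
  by apply: eq_map => x /=; exact: pblock_upside_down.
rewrite /signature -!/(uncrossed_by _) wordE uncrossed_by_rev.
by rewrite (uncrossed_by_map _ flipsK unflipsK).
Qed.

Lemma coarser_upside_down (tau pi : ptset k l) :
  coarser (upside_down tau) (upside_down pi) = coarser tau pi.
Proof.
apply/forallP/forallP => co B; apply/implyP.
  move=> Bpi; have /existsP[C /andP[/imsetP[C' C't ->] BC]] :=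
    implyP (co _) (imset_f _ Bpi).
  apply/existsP; exists C'; rewrite C't /=; apply/fintype.subsetP=> x xB.
  by rewrite -(mem_imset _ _ flip_inj); apply: (fintype.subsetP BC); exact: imset_f.
case/imsetP=> B' B'pi ->; have /existsP[C /andP[Ct BC]] := implyP (co _) B'pi.
by apply/existsP; exists (flip @: C); rewrite imset_f //= imsetS.
Qed.

End UpsideDown.

(** The multi-index i read on the row of reversed colors, as produced by turning
    a partition upside down. *)
Definition bar_multi k n (i : multi k n) : multi (map negb k) n :=
  [ffun r => i (cast_ord (size_map negb k) r)].

Lemma ker_upside_down k l n (i : multi k n) (j : multi l n) :
  ker (bar_multi j) (bar_multi i) = upside_down (ker i j).
Proof.
have glueE x : glue_multi (bar_multi j) (bar_multi i) (flip_pt x) = glue_multi i j x.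
  by case: x => r /=; rewrite ffunE cast_ordKV.
have flip_surj y : exists x : pt k l, y = flip_pt x.
  by exists (unflip_pt y); rewrite unflip_ptK.
have flip_inj := can_inj (@flip_ptK k l).
have blockE x : [set y | glue_multi (bar_multi j) (bar_multi i) (flip_pt x) ==
                        glue_multi (bar_multi j) (bar_multi i) y] =
    @flip_pt k l @: [set y | glue_multi i j x == glue_multi i j y].
  by apply/setP=> y; have [z ->] := flip_surj y; rewrite mem_imset // !inE !glueE.
apply/setP=> B; apply/idP/imsetP => [/ker_blockP[y ->]|[C /ker_blockP[x ->] ->]].
  have [x ->] := flip_surj y; exists [set y | glue_multi i j x == glue_multi i j y].
    exact: mem_ker.
  exact: blockE.
by rewrite -blockE mem_ker.
Qed.

Lemma kron_upside_down q k l n (pi : ptset k l) (i : multi k n) (j : multi l n) :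
  kron q (upside_down pi) (bar_multi j) (bar_multi i) = kron q pi i j.
Proof.
rewrite /kron ker_upside_down coarser_upside_down signature_upside_down //.
exact: preim_partitionP.
Qed.

(** * Matrices over a C*-algebra and their translates *)

Lemma exchange_big_last (V : nmodType) (I J K : finType) (F : I -> J -> K -> V) :
  \sum_i \sum_j \sum_k F i j k = \sum_k \sum_i \sum_j F i j k.
Proof.
rewrite [RHS]exchange_big; apply: eq_bigr => i _; exact: exchange_big.
Qed.

Lemma exchange_big_pairs (V : nmodType) (I J K L : finType)
    (F : I -> J -> K -> L -> V) :
  \sum_i \sum_j \sum_k \sum_l F i j k l = \sum_k \sum_l \sum_i \sum_j F i j k l.
Proof.
by rewrite exchange_big_last; apply: eq_bigr => k _; exact: exchange_big_last.
Qed.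

HB.instance Definition _ (R : realType) (A : cstarType R) :=
  GRing.isZmodMorphism.Build A A (@star R A)
    (fun x y => etrans (starD x (- y)) (congr1 _ (starN y))).

Lemma star_sum (R : realType) (A : cstarType R) (I : finType) (F : I -> A) :
  star (\sum_i F i) = \sum_i star (F i).
Proof. exact: raddf_sum. Qed.

Lemma star_nat (R : realType) (A : cstarType R) n : star (n%:R : A) = n%:R.
Proof. by rewrite raddfMn /= star1. Qed.

Lemma comm_star (R : realType) (A : cstarType R) (x y : A) :
  GRing.comm x y -> GRing.comm (star x) (star y).
Proof. by rewrite /GRing.comm -!starM => ->. Qed.

Lemma antimorph_prod (A B : pzRingType) (phi : A -> B) (I : Type) (r : seq I)
    (F : I -> A) :
  phi 1 = 1 -> (forall x y, phi (x * y) = phi y * phi x) ->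
  phi (\prod_(i <- r) F i) = \prod_(i <- rev r) phi (F i).
Proof.
move=> phi1 phiM; elim: r => [|i r IH]; first by rewrite !big_nil.
by rewrite big_cons phiM IH rev_cons -cats1 big_cat big_seq1.
Qed.

Section StarMatrices.
Variables (R : realType) (A : cstarType R).

Lemma conj_mxK m n (x : 'M[A]_(m, n)) : conj_mx (conj_mx x) = x.
Proof. by apply/matrixP=> i j; rewrite !mxE starK. Qed.

Lemma adj_mxK m n (x : 'M[A]_(m, n)) : adj_mx (adj_mx x) = x.
Proof. by apply/matrixP=> i j; rewrite !mxE starK. Qed.

Lemma adj_conj_mx m n (x : 'M[A]_(m, n)) : adj_mx (conj_mx x) = x^T.
Proof. by rewrite /adj_mx conj_mxK. Qed.

Lemma adj_mxM m n p (x : 'M[A]_(m, n)) (y : 'M[A]_(n, p)) :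
  adj_mx (x *m y) = adj_mx y *m adj_mx x.
Proof.
apply/matrixP=> i j; rewrite !mxE star_sum; apply: eq_bigr => k _.
by rewrite !mxE starM.
Qed.

(** Satisfied by the coordinates of two different tensor factors.  Because of the
    adjoints, the relation is symmetric and stable by conjugation. *)
Definition star_comm_mx m n p r (x : 'M[A]_(m, n)) (y : 'M[A]_(p, r)) :=
  forall i j k l, GRing.comm (x i j) (y k l) /\ GRing.comm (x i j) (star (y k l)).

Lemma star_comm_mx_sym m n p r (x : 'M[A]_(m, n)) (y : 'M[A]_(p, r)) :
  star_comm_mx x y -> star_comm_mx y x.
Proof.
move=> xy k l i j; have [c1 c2] := xy i j k l; split; apply: commr_sym => //.
by rewrite -[y k l]starK; exact: comm_star.
Qed.

Lemma star_comm_mx_conjr m n p r (x : 'M[A]_(m, n)) (y : 'M[A]_(p, r)) :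
  star_comm_mx x y -> star_comm_mx x (conj_mx y).
Proof. by move=> xy i j k l; have [c1 c2] := xy i j k l; rewrite !mxE starK. Qed.

Lemma star_comm_mx_conjl m n p r (x : 'M[A]_(m, n)) (y : 'M[A]_(p, r)) :
  star_comm_mx x y -> star_comm_mx (conj_mx x) y.
Proof.
by move/star_comm_mx_sym/star_comm_mx_conjr/star_comm_mx_sym.
Qed.

Lemma colored_comm m n p r (x : 'M[A]_(m, n)) (y : 'M[A]_(p, r)) e f i j k l :
  star_comm_mx x y -> GRing.comm (colored e (x i j)) (colored f (y k l)).
Proof.
move=> xy; have [c1 c2] := xy i j k l.
have [c3 c4] := star_comm_mx_conjl xy i j k l; rewrite mxE in c3 c4.
by case: e; case: f.
Qed.

Lemma coloredM e (x y : A) : GRing.comm x y ->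
  colored e (x * y) = colored e x * colored e y.
Proof. by case: e => //= xy; rewrite starM; exact/commr_sym/comm_star. Qed.

Lemma colored_sum e (I : finType) (F : I -> A) :
  colored e (\sum_i F i) = \sum_i colored e (F i).
Proof. by case: e => //=; rewrite raddf_sum. Qed.

Lemma colored_nat e n : colored e (n%:R : A) = n%:R.
Proof. by case: e => //=; exact: star_nat. Qed.

Section Translate.
Variables (M N : nat) (x : 'M[A]_M) (y : 'M[A]_N) (v : 'M[A]_(M, N)).

(** In the form x v y^*, unitarity can be used; translateE gives the form in
    which the coordinates of v come last. *)
Definition translate := x *m v *m adj_mx y.

Hypotheses (xy : star_comm_mx x y) (xv : star_comm_mx x v) (yv : star_comm_mx y v).

Lemma translateE i j :
  translate i j = \sum_k \sum_l x i k * star (y j l) * v k l.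
Proof.
rewrite mxE exchange_big; apply: eq_bigr => l _; rewrite !mxE mulr_suml.
apply: eq_bigr => k _; rewrite -!mulrA; congr (_ * _).
by have [_] := star_comm_mx_sym yv k l j l.
Qed.

(** Commutation allows gathering the factors x, those of the conjugate of y and
    those of v, without changing the order inside each of the three products. *)
Lemma tpow_translate s (i : multi s M) (j : multi s N) :
  tpow translate i j =
  \sum_(k : multi s M) \sum_(l : multi s N)
    tpow x i k * tpow (conj_mx y) j l * tpow v k l.
Proof.
have yxc := star_comm_mx_conjr xy; have yvc := star_comm_mx_conjl yv.
pose F r k l := colored (color r) (x (i r) k) *
  colored (color r) (conj_mx y (j r) l) * colored (color r) (v k l).
transitivity (\prod_(r < size s) \sum_k \sum_l F r k l).
  apply: eq_bigr => r _; rewrite translateE colored_sum; apply: eq_bigr => k _.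
  rewrite colored_sum; apply: eq_bigr => l _.
  have [c1 _] := yxc (i r) k (j r) l; have [c2 _] := xv (i r) k k l.
  have [c3 _] := yvc (j r) l k l; rewrite mxE in c1 c3.
  rewrite /F mxE !coloredM //.
  by apply: commr_sym; apply: commrM; exact: commr_sym.
rewrite bigA_distr_bigA; apply: eq_bigr => k _.
rewrite bigA_distr_bigA; apply: eq_bigr => l _.
rewrite prodrM_comm => [|r t _ _].
  by rewrite prodrM_comm // => r t _ _; exact: colored_comm.
by apply: commr_sym; apply: commrM; apply: commr_sym; exact: colored_comm.
Qed.

(** The product of the translate with its adjoint is x P x^*, for P = v v^*, by
    unitarity of y.  Its trace is the sum of the P k l, each multiplied by
    entry (k, l) of x^T times the conjugate of x, because the entries of x and
    P commute. *)
Lemma projection_translate (L : nat) :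
  adj_mx x *m x = 1%:M -> x^T *m conj_mx x = 1%:M -> adj_mx y *m y = 1%:M ->
  projection_of_trace L (v *m adj_mx v) ->
  projection_of_trace L (translate *m adj_mx translate).
Proof.
move=> x1 x2 y1 [vs vv vL].
have -> : translate *m adj_mx translate = x *m (v *m adj_mx v) *m adj_mx x.
  by rewrite /translate !adj_mxM adj_mxK !mulmxA -[_ *m adj_mx y *m y]mulmxA y1 mulmx1.
have xP i k l t : GRing.comm (x i k) ((v *m adj_mx v) l t).
  rewrite mxE; apply: commr_sum => h _; rewrite !mxE.
  by have [c1 _] := xv i k l h; have [_ c2] := xv i k t h; exact: commrM.
move: (v *m adj_mx v) vs vv vL xP => P vs vv vL xP; split.
- by rewrite (adj_mxM (x *m P)) (adj_mxM x P) adj_mxK vs mulmxA.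
- by rewrite !mulmxA -[_ *m adj_mx x *m x]mulmxA x1 mulmx1 -[x *m P *m P]mulmxA vv.
rewrite -vL /mxtrace.
transitivity (\sum_k \sum_l P k l * (\sum_i x i k * star (x i l))).
  under eq_bigr => i _.
    rewrite mxE; under eq_bigr => l _ do rewrite !mxE mulr_suml.
    over.
  rewrite exchange_big; under eq_bigr => l _ do rewrite exchange_big.
  rewrite exchange_big; apply: eq_bigr => k _; apply: eq_bigr => l _.
  by rewrite mulr_sumr; apply: eq_bigr => i _; rewrite xP mulrA.
apply: eq_bigr => k _; rewrite (bigD1 k) //= [X in _ + X]big1 ?addr0 => [|l lk].
  (* The diagonal entries of x^T times the conjugate of x are 1, the others 0. *)
  have := congr1 (fun Z : 'M_M => Z k k) x2; rewrite !mxE eqxx mulr1n => E.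
  by rewrite -[RHS]mulr1 -[in RHS]E; congr (_ * _); apply: eq_bigr => i _; rewrite !mxE.
have := congr1 (fun Z : 'M_M => Z k l) x2; rewrite !mxE eq_sym (negPf lk) mulr0n => E.
rewrite -[RHS](mulr0 (P k l)) -[in RHS]E; congr (_ * _).
by apply: eq_bigr => i _; rewrite !mxE.
Qed.

End Translate.

(** This reduces the conditions on the conjugate of a translate to
    projection_translate. *)
Lemma conj_translate M N (x : 'M[A]_M) (y : 'M[A]_N) (v : 'M[A]_(M, N)) :
  star_comm_mx x y -> star_comm_mx x v -> star_comm_mx y v ->
  conj_mx (translate x y v) = translate (conj_mx x) (conj_mx y) (conj_mx v).
Proof.
move=> xy xv yv; have c := star_comm_mx_conjl (star_comm_mx_conjr yv).
apply/matrixP=> i j; rewrite mxE !translateE // star_sum.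
apply: eq_bigr => k _; rewrite star_sum; apply: eq_bigr => l _.
rewrite !mxE !starM starK.
have [c3 _] := star_comm_mx_conjl xy i k j l; have [_ c4] := yv j l k l.
have [_ c5] := star_comm_mx_conjl xv i k k l; rewrite !mxE in c3 c5.
by rewrite c3 -mulrA c5 !mulrA c4.
Qed.

(** The Kronecker symbols of the partitions in D without upper legs, seen as
    linear forms on tensor powers, are invariant under x.  The sum is over row
    indices, the ones contracted in the relations of X. *)
Definition fixes_kron (q : int) (D : part_family) n (x : 'M[A]_n) : Prop :=
  forall s (pi : ptset [::] s), pi \in D [::] s -> forall k : multi s n,
    \sum_(i : multi s n) tpow x i k *~ kron q pi (no_index n) i =
    (kron q pi (no_index n) k)%:~R.

(** Both Kronecker symbols are absorbed by the invariance of x and of the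
    conjugate of y, which leaves the sum attached to v. *)
Lemma GMNL_rel_translate q D L M N (x : 'M[A]_M) (y : 'M[A]_N) (v : 'M[A]_(M, N)) :
  unitary_mx x -> unitary_mx (conj_mx x) -> unitary_mx y -> unitary_mx (conj_mx y) ->
  fixes_kron q D x -> fixes_kron q D (conj_mx y) ->
  star_comm_mx x y -> star_comm_mx x v -> star_comm_mx y v ->
  GMNL_rel q D L v -> GMNL_rel q D L (translate x y v).
Proof.
move=> [_ x1] [_ x2] [_ y1] [_ y2] xfix yfix xy xv yv [[p1 p2] vrel].
rewrite adj_conj_mx in x2; split; first split.
- exact: projection_translate.
- rewrite -adj_conj_mx conj_translate //; apply: projection_translate => //.
  + exact/star_comm_mx_conjl/star_comm_mx_conjr.
  + by rewrite adj_conj_mx.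
  + by rewrite conj_mxK.
  + by rewrite adj_conj_mx.
move=> s pi sigma pis sis; rewrite -(vrel s pi sigma pis sis).
transitivity (\sum_(k : multi s M) \sum_(l : multi s N)
   (\sum_(i : multi s M) tpow x i k *~ kron q pi (no_index M) i) *
   (\sum_(j : multi s N) tpow (conj_mx y) j l *~ kron q sigma (no_index N) j) *
   tpow v k l).
  transitivity (\sum_(i : multi s M) \sum_(j : multi s N) \sum_(k : multi s M)
      \sum_(l : multi s N) (tpow x i k * tpow (conj_mx y) j l * tpow v k l) *~
      (kron q pi (no_index M) i * kron q sigma (no_index N) j)).
    apply: eq_bigr => i _; apply: eq_bigr => j _; rewrite tpow_translate // mulrz_suml.
    by apply: eq_bigr => k _; rewrite mulrz_suml.
  rewrite exchange_big_pairs; apply: eq_bigr => k _; apply: eq_bigr => l _.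
  rewrite mulr_suml mulr_suml; apply: eq_bigr => i _.
  rewrite mulr_sumr mulr_suml; apply: eq_bigr => j _.
  by rewrite mulrzA !(mulrzAl, mulrzAr) mulrzAC.
apply: eq_bigr => k _; apply: eq_bigr => l _.
by rewrite xfix // yfix // -rmorphM /= mulrzl.
Qed.

End StarMatrices.

(** * Fixed vectors of a quizzy quantum group *)

Lemma sum_multi0 (V : nmodType) n (F : multi [::] n -> V) :
  \sum_(i : multi [::] n) F i = F (no_index n).
Proof.
by rewrite (big_pred1 (no_index n)) // => i; apply/esym/eqP/ffunP => -[].
Qed.

Lemma tpow_nil (R : realType) (A : cstarType R) m n (x : 'M[A]_(m, n)) i j :
  @tpow R A m n x [::] i j = 1.
Proof. exact: big_ord0. Qed.

Lemma tpow_map (R : realType) (A B : cstarType R) (f : starHom A B) m n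
    (x : 'M[A]_(m, n)) s (i : multi s m) (j : multi s n) :
  tpow (map_mx f x) i j = f (tpow x i j).
Proof.
rewrite /tpow rmorph_prod; apply: eq_bigr => r _; rewrite mxE /colored.
by case: color; rewrite /= ?starHom_star.
Qed.

Lemma conj_mx_map (R : realType) (A B : cstarType R) (f : starHom A B) m n
    (x : 'M[A]_(m, n)) :
  conj_mx (map_mx f x) = map_mx f (conj_mx x).
Proof. by apply/matrixP=> i j; rewrite !mxE starHom_star. Qed.

Lemma adj_mx_map (R : realType) (A B : cstarType R) (f : starHom A B) m n
    (x : 'M[A]_(m, n)) :
  adj_mx (map_mx f x) = map_mx f (adj_mx x).
Proof. by apply/matrixP=> i j; rewrite !mxE starHom_star. Qed.

Lemma unitary_mx_map (R : realType) (A B : cstarType R) (f : starHom A B) n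
    (x : 'M[A]_n) :
  unitary_mx x -> unitary_mx (map_mx f x).
Proof.
by case=> x1 x2; split; rewrite adj_mx_map -map_mxM /= ?x1 ?x2 map_mx1.
Qed.

Lemma fixes_kron_map (R : realType) (A B : cstarType R) (f : starHom A B) q D n
    (x : 'M[A]_n) :
  fixes_kron q D x -> fixes_kron q D (map_mx f x).
Proof.
move=> xfix s pi pis k; rewrite -(rmorph_int f) -(xfix s pi pis k) rmorph_sum.
by apply: eq_bigr => i _; rewrite tpow_map rmorphMz.
Qed.

Lemma tpow_upside_down (R : realType) (A : cstarType R) m n (x : 'M[A]_(m, n)) s
    (i : multi s m) (j : multi s n) :
  tpow x (bar_multi i) (bar_multi j) = tpow (conj_mx x) i j.
Proof.
have prod_cast (a b : nat) (e : a = b) (F : 'I_b -> A) :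
    \prod_(r < b) F r = \prod_(r < a) F (cast_ord e r).
  by case: b / e F => F; apply: eq_bigr => r _; rewrite cast_ord_id.
rewrite /tpow (prod_cast _ _ (esym (size_map negb s))); apply: eq_bigr => r _.
rewrite !ffunE cast_ordKV mxE.
have -> : color (cast_ord (esym (size_map negb s)) r) = ~~ color r.
  by rewrite /color !(tnth_nth white) /= (nth_map white) ?ltn_ord.
by case: (color r) => //=; rewrite starK.
Qed.

Section FixedVectors.
Variables (R : realType) (tens : forall A B : cstarType R, max_tensor A B).
Variables (q : int) (D : part_family) (n : nat) (G : cmqg tens n).
Hypothesis Gq : quizzy q D G.

Lemma intertwiner_kron k l (pi : ptset k l) : pi \in D k l ->
  intertwiner (qg_u G) (fun j i => (kron q pi i j)%:~R).
Proof.
move=> pikl; apply/Gq; exists (fun rho => (rho == pi)%:R) => j i.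
rewrite (bigD1 pi) //= eqxx mul1r big1 ?addr0 // => rho /andP[_ /negPf ->].
by rewrite mul0r.
Qed.

(** The antipode and the star both reverse products, so the monomial keeps its
    order and its colors while every coordinate is transposed. *)
Lemma antipode_tpow s (i j : multi s n) :
  qg_antipode G (tpow (qg_u G) i j) = star (tpow (qg_u G) j i).
Proof.
rewrite (antimorph_prod _ _ (qg_antipode1 G) (@qg_antipodeM _ _ _ G)).
rewrite (antimorph_prod _ _ (star1 _) (@starM _ _)); apply: eq_bigr => r _.
by case: color => /=; rewrite ?qg_antipode_star qg_antipodeE.
Qed.

(** The Kronecker symbol of pi is a vector fixed by u^s, which is a sum over
    column indices.  Applying the antipode, then the star, turns it into a sum
    over row indices; the symbol is unchanged, being an integer. *)
Lemma fixes_kron_coordinates : fixes_kron q D (qg_u G).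
Proof.
move=> s pi pis k; have := intertwiner_kron pis k (no_index n).
rewrite sum_multi0 tpow_nil scaler_int => /(congr1 (qg_antipode G))/(congr1 star).
rewrite !raddfMz /= qg_antipode1 star1 => ->.
rewrite raddf_sum star_sum; apply: eq_bigr => i _.
by rewrite scaler_int !raddfMz /= antipode_tpow starK.
Qed.

(** Turned upside down, pi gives an intertwiner from the tensor power of u with
    reversed colors, which is the tensor power of the conjugate of u, to 1.
    For such intertwiners the sum is over row indices already. *)
Lemma fixes_kron_conj_coordinates : category_of_partitions D ->
  fixes_kron q D (conj_mx (qg_u G)).
Proof.
move=> Dcat s pi pis k.
have := intertwiner_kron (cat_upside_down Dcat pis) (no_index n) (bar_multi k).
rewrite sum_multi0 tpow_nil scaler_int.
have barE (i : multi s n) : kron q (upside_down pi) (bar_multi i) (no_index n) =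
    kron q pi (no_index n) i.
  rewrite -[RHS]kron_upside_down; congr (kron _ _ _ _).
  by apply/ffunP=> -[].
rewrite barE => <-.
pose unbar (i : multi (map negb s) n) : multi s n :=
  [ffun r => i (cast_ord (esym (size_map negb s)) r)].
have barK : cancel (@bar_multi s n) unbar.
  by move=> i; apply/ffunP=> r; rewrite !ffunE cast_ordKV.
have unbarK : cancel unbar (@bar_multi s n).
  by move=> i; apply/ffunP=> r; rewrite !ffunE cast_ordK.
rewrite (reindex (@bar_multi s n)); last by exists unbar => i _.
by apply: eq_bigr => i _; rewrite barE scaler_int tpow_upside_down.
Qed.

End FixedVectors.

(** * The base point *)

Definition widen_multi s L M (hLM : (L <= M)%N) (c : multi s L) : multi s M :=
  [ffun r => widen_ord hLM (c r)].

Lemma ker_widen_multi s L M (hLM : (L <= M)%N) (c : multi s L) :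
  ker (no_index M) (widen_multi hLM c) = ker (no_index L) c.
Proof. by apply: eq_ker => -[[]//|r] [[]//|t]; rewrite /= !ffunE. Qed.

Section BasePoint.
Variables (R : realType) (A : cstarType R).
Variables (L M N : nat) (hLM : (L <= M)%N) (hLN : (L <= N)%N).

Local Notation J := (pid_mx L : 'M[A]_(M, N)).

Lemma pid_mx_sum (i : 'I_M) (j : 'I_N) : (pid_mx L : 'M[A]_(M, N)) i j =
  \sum_(c < L) ((i == widen_ord hLM c) && (j == widen_ord hLN c))%:R.
Proof.
rewrite mxE; case: (ltnP i L) => [iL|Li].
  rewrite (bigD1 (Ordinal iL)) //= big1 ?addr0 => [|c ic].
    by congr (nat_of_bool _)%:R; rewrite andbT -!val_eqE /= eqxx andTb [RHS]eq_sym.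
  have /negPf -> // : i != widen_ord hLM c.
  by apply: contraNneq ic => iE; apply/eqP/val_inj; rewrite /= iE.
rewrite andbF big1 // => c _; rewrite -val_eqE /= gtn_eqF //.
exact: leq_trans (ltn_ord c) Li.
Qed.

Lemma conj_pid_mx m n : conj_mx (pid_mx L : 'M[A]_(m, n)) = pid_mx L.
Proof. by apply/matrixP=> i j; rewrite !mxE star_nat. Qed.

(** The entries of J are 0 or 1, so the monomial tests whether the row and
    column multi-indices agree and come from a multi-index below L. *)
Lemma tpow_pid_mx s (i : multi s M) (j : multi s N) :
  tpow J i j = \sum_(c : multi s L)
    ((i == widen_multi hLM c) && (j == widen_multi hLN c))%:R.
Proof.
have colored_pid e k l : colored e (J k l) = J k l.
  by rewrite mxE colored_nat.
rewrite /tpow; under eq_bigr => r _ do rewrite colored_pid pid_mx_sum.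
rewrite bigA_distr_bigA; apply: eq_bigr => c _.
have natr_and (b1 b2 : bool) : (b1 && b2)%:R = b1%:R * b2%:R :> A.
  by rewrite -natrM mulnb.
rewrite -(big_morph (fun b : bool => b%:R : A) natr_and (erefl : true%:R = 1 :> A)) big_andE.
congr (nat_of_bool _)%:R; apply/forallP/andP => [ij|[/eqP -> /eqP ->] r].
  split; apply/eqP/ffunP=> r; rewrite ffunE; apply/eqP; by case/andP: (ij r).
by rewrite !ffunE !eqxx.
Qed.

Lemma partial_isometry_pid_mx : partial_isometry_rel L J.
Proof.
have proj m n (Lm : (L <= m)%N) (Ln : (L <= n)%N) : projection_of_trace L
    ((pid_mx L : 'M[A]_(m, n)) *m pid_mx L).
  rewrite mul_pid_mx minnn (minn_idPr Ln); split.
  - by rewrite /adj_mx conj_pid_mx tr_pid_mx.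
  - by rewrite mul_pid_mx minnn (minn_idPr Lm).
  - rewrite /mxtrace; under eq_bigr => i _ do rewrite mxE eqxx /=.
    rewrite -natr_sum; congr _%:R; rewrite -[RHS]card_ord -sum1_card.
    rewrite (big_ord_widen _ (fun=> 1%N) Lm) [RHS]big_mkcond.
    by apply: eq_bigr => i _; case: ltnP.
split; first by rewrite /adj_mx conj_pid_mx tr_pid_mx; exact: proj.
by rewrite conj_pid_mx tr_pid_mx; exact: proj.
Qed.

(** The multi-indices on both sides have the same kernel, so their signs
    multiply to 1 and the sum counts the multi-indices below L that are
    constant on the blocks of pi and sigma. *)
Lemma GMNL_rel_pid_mx q (D : part_family) :
  (forall k l pi, pi \in D k l -> partition pi [set: pt k l]) -> GMNL_rel q D L J.
Proof.
move=> Dpart; split=> [|s pi sigma pis sis]; first exact: partial_isometry_pid_mx.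
rewrite -card_constant_on_join; [|exact: Dpart..].
transitivity (\sum_(c : multi s L) (1 : A) *~
   (kron q pi (no_index M) (widen_multi hLM c) *
    kron q sigma (no_index N) (widen_multi hLN c))).
  transitivity (\sum_(i : multi s M) \sum_(j : multi s N) \sum_(c : multi s L)
     ((i == widen_multi hLM c) && (j == widen_multi hLN c))%:R *~
     (kron q pi (no_index M) i * kron q sigma (no_index N) j) : A).
    apply: eq_bigr => i _; apply: eq_bigr => j _.
    by rewrite tpow_pid_mx mulrz_suml.
  rewrite exchange_big_last.
  apply: eq_bigr => c _; rewrite (bigD1 (widen_multi hLM c)) //=.
  rewrite (bigD1 (widen_multi hLN c)) //= !eqxx big1 ?addr0 => [|j /negPf ->]; last first.
    by rewrite andbF mul0rz.
  rewrite big1 ?addr0 // => i /negPf ->; rewrite big1 // => j _.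
  by rewrite mul0rz.
rewrite -sum1_card natr_sum [RHS]big_mkcond /=; apply: eq_bigr => c _.
rewrite inE !kronE !ker_widen_multi mulrACA -expr2 block_sign_sqr mulr1.
by case: coarser; case: coarser.
Qed.

Lemma translate_pid_mx (x : 'M[A]_M) (y : 'M[A]_N) i j :
  translate x y J i j =
  \sum_(l < L) x i (widen_ord hLM l) * star (y j (widen_ord hLN l)).
Proof.
rewrite translateE => [|? ? ? ?]; last first.
  by rewrite mxE star_nat; split; exact: commr_nat.
transitivity (\sum_k \sum_l \sum_c x i k * star (y j l) *
    ((k == widen_ord hLM c) && (l == widen_ord hLN c))%:R).
  apply: eq_bigr => k _; apply: eq_bigr => l _.
  by rewrite pid_mx_sum mulr_sumr.
rewrite exchange_big_last.
apply: eq_bigr => c _; rewrite (bigD1 (widen_ord hLM c)) //=.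
rewrite (bigD1 (widen_ord hLN c)) //= !eqxx mulr1 big1 ?addr0 => [|j' /negPf ->]; last first.
  by rewrite andbF mulr0.
rewrite big1 ?addr0 // => k /negPf ->; rewrite big1 // => l _.
by rewrite mulr0.
Qed.

End BasePoint.

(** * The action of the product quantum group *)

Section TensorPure.
Variables (R : realType) (A B : cstarType R) (T : max_tensor A B).

Lemma tpure_suml (I : finType) (F : I -> A) y :
  tpure T (\sum_i F i) y = \sum_i tpure T (F i) y.
Proof. by rewrite /tpure rmorph_sum mulr_suml. Qed.

Lemma tpure_sumr (I : finType) x (F : I -> B) :
  tpure T x (\sum_i F i) = \sum_i tpure T x (F i).
Proof. by rewrite /tpure rmorph_sum mulr_sumr. Qed.

Lemma star_tpure x y : star (tpure T x y) = tpure T (star x) (star y).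
Proof.
by rewrite /tpure starM -!starHom_star; exact/commr_sym/tens_comm.
Qed.
End TensorPure.

Section ProductGroup.
Variables (R : realType) (tens : forall A B : cstarType R, max_tensor A B).
Variables (m n : nat) (G : cmqg tens m) (H : cmqg tens n).

(** The coordinates of the tensor product of the fundamental representation of
    G with the conjugate of that of H. *)
Definition prod_coef i j k l : prod_alg G H :=
  tpure (prod_alg G H) (qg_u G i k) (star (qg_u H j l)).

(** These are matrix coefficients of a representation of the product, whose
    comultiplication is matrix multiplication. *)
Lemma prod_comul_coef i j k l :
  prod_comul G H (prod_coef i j k l) =
  \sum_s \sum_t tpure (tens _ _) (prod_coef i j s t) (prod_coef s t k l).
Proof.
rewrite /prod_comul /= tmap_pure starHom_star !qg_comulE star_sum tpure_suml.
rewrite rmorph_sum; apply: eq_bigr => s _.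
rewrite tpure_sumr rmorph_sum; apply: eq_bigr => t _.
by rewrite star_tpure; exact: flip_mid_pure.
Qed.

Lemma prod_counit_coef i j k l :
  prod_counit G H (prod_coef i j k l) = ((i == k) && (j == l))%:R.
Proof.
rewrite /prod_counit rmorphM /= tlift_inl tlift_inr starHom_star !qg_counitE.
by rewrite star_nat -natrM mulnb.
Qed.

End ProductGroup.

Lemma GMNL_rel_map (R : realType) (A B : cstarType R) (f : starHom A B) q D L M N
    (v : 'M[A]_(M, N)) :
  GMNL_rel q D L v -> GMNL_rel q D L (map_mx f v).
Proof.
have proj m (r : 'M[A]_m) : projection_of_trace L r ->
    projection_of_trace L (map_mx f r).
  case=> r1 r2 r3; split; first by rewrite adj_mx_map r1.
    by rewrite -map_mxM r2.
  by rewrite -(rmorph_nat f) -r3 /mxtrace rmorph_sum; apply: eq_bigr => i _; rewrite mxE.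
case=> [[p1 p2] vrel]; split=> [|s pi sigma pis sis].
  split; first by rewrite adj_mx_map -map_mxM; exact: proj.
  by rewrite conj_mx_map matrix.map_trmx -map_mxM; exact: proj.
rewrite -(rmorph_nat f) -(vrel s pi sigma pis sis) rmorph_sum.
apply: eq_bigr => i _; rewrite rmorph_sum; apply: eq_bigr => j _.
by rewrite tpow_map rmorphMz.
Qed.

(** Morphisms preserve unitarity and the invariance of the Kronecker symbols, so
    the coordinates may be translated inside any common algebra C. *)
Lemma GMNL_rel_action (R : realType) (tens : forall A B : cstarType R, max_tensor A B)
    (q : int) (D : part_family) (G : forall n, cmqg tens n) (L M N : nat)
    (C : cstarType R) (f : starHom (qg_alg (G M)) C) (g : starHom (qg_alg (G N)) C)
    (v : 'M[C]_(M, N)) :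
  uniform_quizzy q D G -> (0 < M)%N -> (0 < N)%N ->
  (forall x y, GRing.comm (f x) (g y)) ->
  (forall x k l, GRing.comm (f x) (v k l)) ->
  (forall y k l, GRing.comm (g y) (v k l)) ->
  GMNL_rel q D L v ->
  GMNL_rel q D L (translate (map_mx f (qg_u (G M))) (map_mx g (qg_u (G N))) v).
Proof.
move=> hG M0 N0 fg fv gv.
have [aU aU'] := uq_free_unitary hG M0; have [bU bU'] := uq_free_unitary hG N0.
have star_commP (A : cstarType R) (h : starHom A C) (z : C) :
    (forall x, GRing.comm (h x) z) -> forall x, GRing.comm (h x) (star z).
  by move=> hz x; rewrite -[x]starK starHom_star; exact: comm_star.
apply: GMNL_rel_translate; rewrite ?conj_mx_map; do ?exact: unitary_mx_map.
- exact/fixes_kron_map/fixes_kron_coordinates/(uq_quizzy hG).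
- apply/fixes_kron_map/fixes_kron_conj_coordinates/(uq_category hG).
  exact: (uq_quizzy hG).
- by move=> i k j l; rewrite !mxE -starHom_star.
- by move=> i k j l; rewrite !mxE; split=> //; exact: star_commP.
- by move=> i k j l; rewrite !mxE; split=> //; exact: star_commP.
Qed.

Theorem theorem4p5 (R : realType)
    (tens : forall A B : cstarType R, max_tensor A B)
    (q : int) (D : part_family) (G : forall n, cmqg tens n)
    (hG : uniform_quizzy q D G)
    (L M N : nat) (hM : (0 < M)%N) (hLM : (L <= M)%N) (hMN : (M <= N)%N)
    (CX : cstarType R) (u : 'M[CX]_(M, N))
    (hX : universal_cstar (@GMNL_rel R q D L M N) u) :
  let a := qg_u (G M) in
  let b := qg_u (G N) in
  let GMN := prod_alg (G M) (G N) in
  exists (Phi : starHom CX (tens GMN CX)) (p : starHom CX GMN),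
    [/\ forall i j, Phi (u i j) =
          \sum_k \sum_l
            tpure (tens GMN CX) (tpure GMN (a i k) (star (b j l))) (u k l),
        forall i j, p (u i j) =
          \sum_(l < L) tpure GMN (a i (widen_ord hLM l))
            (star (b j (widen_ord (leq_trans hLM hMN) l))),
        is_qaction (prod_comul (G M) (G N)) (prod_counit (G M) (G N)) Phi &
        forall x, tmap (tens GMN CX) (tens GMN GMN) (idH GMN) p (Phi x) =
                  prod_comul (G M) (G N) (p x)].
Proof.
move=> a b GMN; have hLN := leq_trans hLM hMN; have hN := leq_trans hM hMN.
have [urel uext uuniq] := hX.
pose g i j k l : GMN := prod_coef (G M) (G N) i j k l.
have [Phi PhiE] : exists Phi : starHom CX (tens GMN CX), forall i j,
    Phi (u i j) = \sum_k \sum_l tpure (tens GMN CX) (g i j k l) (u k l).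
  (* Phi is the translate of u inside C(G_M) (x) C(G_N) (x) C(X). *)
  pose f := compH (tinl (tens GMN CX)) (tinl GMN).
  pose h := compH (tinl (tens GMN CX)) (tinr GMN).
  pose v := map_mx (tinr (tens GMN CX)) u.
  have hv y k l : GRing.comm (h y) (v k l) by rewrite mxE; exact: tens_comm.
  have [|Phi PhiE] := uext _ (translate (map_mx f a) (map_mx h b) v).
    apply: GMNL_rel_action => // [x y|x k l|].
    - by rewrite /GRing.comm /= -!rmorphM tens_comm.
    - by rewrite mxE; exact: tens_comm.
    - exact: GMNL_rel_map.
  exists Phi => i j; rewrite PhiE translateE => [|k l s t]; last first.
    by rewrite !mxE -starHom_star; split; exact: tens_comm.
  apply: eq_bigr => k _; apply: eq_bigr => l _.
  by rewrite !mxE /tpure /= -!starHom_star -rmorphM.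
have [p pE] : exists p : starHom CX GMN, forall i j,
    p (u i j) = \sum_(l < L) g i j (widen_ord hLM l) (widen_ord hLN l).
  (* p is the translate of J; as J is scalar, it commutes with everything. *)
  have scal x k l : GRing.comm x ((pid_mx L : 'M[GMN]_(M, N)) k l).
    by rewrite mxE; exact: commr_nat.
  have [|p pE] := uext _ (translate (map_mx (tinl GMN) a) (map_mx (tinr GMN) b) (pid_mx L)).
    apply: GMNL_rel_action => //; first exact: tens_comm.
    apply: GMNL_rel_pid_mx => // k l pi; exact: (cat_partition (uq_category hG)).
  exists p => i j; rewrite pE (translate_pid_mx hLM hLN); apply: eq_bigr => l _.
  by rewrite !mxE -starHom_star.
exists Phi, p; split=> //.
- move=> i j; rewrite pE; apply: eq_bigr => l _.
  by congr (tpure _ _ (star (b _ _))); apply: val_inj.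
- split=> x.
    apply: (uuniq _ (compH (compH (tassoc (tens (tens GMN GMN) CX) (tens GMN (tens GMN CX)))
        (tmap _ _ (prod_comul (G M) (G N)) (idH CX))) Phi)
      (compH (tmap (tens GMN CX) (tens GMN (tens GMN CX)) (idH GMN) Phi) Phi)) => i j /=.
    rewrite PhiE !rmorph_sum /=.
    transitivity (\sum_k \sum_l \sum_s \sum_t tpure (tens GMN (tens GMN CX))
        (g i j s t) (tpure (tens GMN CX) (g s t k l) (u k l))).
      apply: eq_bigr => k _; rewrite !rmorph_sum; apply: eq_bigr => l _ /=.
      rewrite tmap_pure prod_comul_coef tpure_suml rmorph_sum.
      apply: eq_bigr => s _; rewrite tpure_suml rmorph_sum; apply: eq_bigr => t _.
      exact: tassoc_pure.
    rewrite exchange_big_pairs; apply: eq_bigr => s _; rewrite rmorph_sum.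
    apply: eq_bigr => t _; rewrite /= tmap_pure PhiE tpure_sumr.
    by apply: eq_bigr => k _; rewrite tpure_sumr.
  apply: (uuniq _ (compH (slice (tens GMN CX) (prod_counit (G M) (G N))) Phi) (idH CX)).
  move=> i j /=; rewrite PhiE rmorph_sum (bigD1 i) //= rmorph_sum (bigD1 j) //=.
  rewrite slice_pure prod_counit_coef !eqxx scale1r.
  rewrite big1 ?addr0 => [|l /negPf jl]; last first.
    by rewrite slice_pure prod_counit_coef eqxx eq_sym jl scale0r.
  rewrite big1 ?addr0 // => k /negPf ik; rewrite rmorph_sum big1 // => l _ /=.
  by rewrite slice_pure prod_counit_coef eq_sym ik scale0r.
move=> x; apply: (uuniq _ (compH (tmap (tens GMN CX) (tens GMN GMN) (idH GMN) p) Phi)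
  (compH (prod_comul (G M) (G N)) p)) => i j /=.
rewrite PhiE pE !rmorph_sum.
transitivity (\sum_k \sum_l \sum_(c < L) tpure (tens GMN GMN) (g i j k l)
    (g k l (widen_ord hLM c) (widen_ord hLN c))).
  apply: eq_bigr => k _; rewrite rmorph_sum; apply: eq_bigr => l _.
  by rewrite /= tmap_pure pE tpure_sumr.
rewrite exchange_big_last.
apply: eq_bigr => c _; exact/esym/prod_comul_coef.
Qed.
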